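(* Let $X$ and $Y$ be computable metric spaces, and let $f:X\to Y$ be Hölder continuous. Then $f$ is limit computable if and only if $f$ is computable relative to the halting problem.
   Context: A function $f:X\to Y$ between metric spaces $(X,d_X),(Y,d_Y)$ is Hölder continuous if there are a constant $L>0$ and an exponent $\alpha\in(0,1]$ with $d_Y(f(x),f(y))\leq L\,d_X(x,y)^\alpha$ for all $x,y\in X$ (Lipschitz continuity is the case $\alpha=1$). A computable metric space $(X,d,\alpha)$ is a metric space $(X,d)$ with a dense sequence $\alpha:\mathbb{N}\to X$ such that $d\circ(\alpha\times\alpha):\mathbb{N}^2\to\mathbb{R}$ is a computable (double) sequence of reals. It is represented by its Cauchy representation $\delta_X:\subseteq\mathbb{N}^{\mathbb{N}}\to X$, $\delta_X(p):=\lim_{n\to\infty}\alpha p(n)$ with $\mathrm{dom}(\delta_X)=\{p:(\forall k)(\forall n\geq k)\;d(\alpha p(n),\alpha p(k))<2^{-k}$ and $(\alpha p(n))_n$ converges$\}$. A function $f:X\to Y$ is limit computable, or computable relative to the halting problem, if it has a realizer with that property, i.e. such an $F:\subseteq\mathbb{N}^{\mathbb{N}}\to\mathbb{N}^{\mathbb{N}}$ with $\delta_YF(p)=f\delta_X(p)$ for all $p\in\mathrm{dom}(\delta_X)$. A partial function $F:\subseteq\mathbb{N}^{\mathbb{N}}\to\mathbb{N}^{\mathbb{N}}$ is computable if there is a Turing machine (infinite input tape, one-way output tape) that on each $p\in\mathrm{dom}(F)$ produces $F(p)$ in the long run; it is limit computable if there is a Turing machine with a two-way output tape (it may revise its output)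 that on each $p\in\mathrm{dom}(F)$ computes $F(p)$ such that each output position $n$ has, after finitely many steps, the content $F(p)(n)$ and is never changed again; it is computable relative to $q\in\mathbb{N}^{\mathbb{N}}$ if there is a computable $G$ with $F(p)=G\langle q,p\rangle$ for all $p\in\mathrm{dom}(F)$, where $\langle q,p\rangle(2n):=q(n)$, $\langle q,p\rangle(2n+1):=p(n)$. Nothing is required outside $\mathrm{dom}(F)$. The halting problem $0'\in\mathbb{N}^{\mathbb{N}}$ is given by $0'(i)=1$ if the $i$-th Turing machine halts on input $000\dots$, and $0'(i)=0$ otherwise. *)

(* Defs.v *)
From HB Require Import structures.
From mathcomp Require Import all_boot all_order all_algebra.
From mathcomp Require Import all_classical all_reals all_analysis.
Set Implicit Arguments.
Unset Strict Implicit.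
Unset Printing Implicit Defensive.
Import Order.TTheory GRing.Theory Num.Theory.
Import numFieldNormedType.Exports.
Local Open Scope classical_set_scope.
Local Open Scope ring_scope.

(** * Turing machines on infinite sequences *)

Inductive move := MoveL | Stay | MoveR.

Definition move_code (m : move) : option bool :=
  match m with MoveL => Some false | Stay => None | MoveR => Some true end.
Definition move_decode (b : option bool) : move :=
  match b with Some false => MoveL | None => Stay | Some true => MoveR end.
Lemma move_codeK : cancel move_code move_decode. Proof. by case. Qed.
HB.instance Definition _ := Countable.copy move (can_type move_codeK).

(** A machine has a read-only input tape over {0,1} (with 1 = [true]), a work
    tape, and an output tape over {0,1} and the blank [None].  All tapes are
    infinite to the right, and a left move on cell 0 has no effect.  States and
    work symbols are natural numbers, of which the (finite) table of a machine
    uses finitely many; the initial state and the blank work symbol are 0. *)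
Definition scan : Type := nat * bool * nat * option bool.
    (* state, scanned input, work and output symbol *)
Definition action : Type := nat * nat * option bool * (move * move * move).
    (* new state, written work and output symbol,
       head moves on the input, work and output tape *)
Definition machine : Type := seq (scan * action).

Record config := Config {
  state : nat;
  in_pos : nat;
  work : nat -> nat;
  work_pos : nat;
  out : nat -> option bool;
  out_pos : nat }.

Definition init : config := Config 0 0 (fun=> 0%N) 0 (fun=> None) 0.

Definition shift (m : move) (i : nat) : nat :=
  match m with MoveL => i.-1 | Stay => i | MoveR => i.+1 end.

(** The first matching entry applies, so every table is deterministic; if no
    entry matches, the machine halts ([None]). *)
Definition lookup (M : machine) (k : scan) : option action :=
  ohead [seq e.2 | e <- M & e.1 == k].

Definition step (M : machine) (inp : nat -> bool) (c : config) :
    option config :=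
  if lookup M (state c, inp (in_pos c), work c (work_pos c), out c (out_pos c))
    is Some (q, w, o, (mi, mw, mo))
  then Some (Config q
    (shift mi (in_pos c))
    [eta work c with work_pos c |-> w] (shift mw (work_pos c))
    [eta out c with out_pos c |-> o] (shift mo (out_pos c)))
  else None.

Definition run (M : machine) (inp : nat -> bool) (t : nat) : config :=
  iter t (fun c => odflt c (step M inp c)) init.

(** One-way output: the output head either stays without writing, or writes a
    symbol and moves right. *)
Definition one_way (M : machine) : Prop :=
  forall k a, (k, a) \in M ->
  let: (_, _, _, o) := k in
  let: (_, _, o', (_, _, mo)) := a in
  (mo = Stay /\ o' = o) \/ (mo = MoveR /\ o' <> None).

(** * Computability on Baire space *)

Definition baire := nat -> nat.

(** [p] is written on a tape as the binary word 1^(p 0) 0 1^(p 1) 0 ...; its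
    first [n.+1] blocks cover cell [n]. *)
Definition tape (p : baire) (n : nat) : bool :=
  nth false (flatten [seq rcons (nseq (p i) true) false | i <- iota 0 n.+1]) n.

(** Every cell of the output tape eventually holds the required symbol and is
    never changed again; this makes sense for both kinds of output tape. *)
Definition produces (M : machine) (p q : baire) : Prop :=
  forall n, exists t0, forall t, (t0 <= t)%N ->
    out (run M (tape p) t) n = Some (tape q n).

Definition halts (M : machine) (p : baire) : Prop :=
  exists t, step M (tape p) (run M (tape p) t) = None.

Definition pfun := baire -> option baire.

Definition computable (F : pfun) : Prop :=
  exists2 M, one_way M & forall p q, F p = Some q -> produces M p q.

Definition limit_computable (F : pfun) : Prop :=
  exists M, forall p q, F p = Some q -> produces M p q.

Definition join (q p : baire) : baire :=
  fun n => if odd n then p n./2 else q n./2.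

Definition computable_relative_to (r : baire) (F : pfun) : Prop :=
  exists2 G, computable G & forall p q, F p = Some q -> G (join r p) = Some q.

(** [unpickle] is defined everywhere on codes of sequences, so this enumerates
    all machines. *)
Definition nth_machine (i : nat) : machine := odflt [::] (unpickle i).

Definition zero_seq : baire := fun=> 0%N.

Definition halting_problem : baire :=
  fun i => if `[< halts (nth_machine i) zero_seq >] then 1%N else 0%N.

Definition computable_seq (h : baire) : Prop :=
  exists2 M, one_way M & produces M zero_seq h.

(** The sequence is approximated by a computable sequence of rationals
    (-1)^s a / (b + 1), indexed by codes of triples. *)
Definition computable_double_seq (R : realType) (x : nat -> nat -> R) : Prop :=
  exists s a b : baire,
    [/\ computable_seq s, computable_seq a, computable_seq b &
     forall i j k : nat, let c := pickle (i, j, k) in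
       `| x i j - (-1) ^+ s c * (a c)%:R / (b c).+1%:R | <= 2^-1 ^+ k].

(** * Computable metric spaces *)

Record computableMetricSpace (R : realType) := ComputableMetricSpace {
  cms_space :> metricType R;
  cms_seq : nat -> cms_space;
  cms_dense : dense (range cms_seq);
  cms_computable :
    computable_double_seq (fun i j => mdist (cms_seq i) (cms_seq j)) }.

(** The graph of the Cauchy representation: [delta_X p = x]. *)
Definition cauchy_rep (R : realType) (X : computableMetricSpace R)
    (p : baire) (x : X) : Prop :=
  (forall k n : nat, (k <= n)%N ->
     mdist (cms_seq X (p n)) (cms_seq X (p k)) < 2^-1 ^+ k) /\
  (fun n => cms_seq X (p n)) @ \oo --> x.

Definition realizer (R : realType) (X Y : computableMetricSpace R)
    (F : pfun) (f : X -> Y) : Prop :=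
  forall p x, cauchy_rep p x -> exists2 q, F p = Some q & cauchy_rep q (f x).

Definition limit_computable_map (R : realType) (X Y : computableMetricSpace R)
    (f : X -> Y) : Prop :=
  exists2 F, realizer F f & limit_computable F.

Definition computable_map_relative_to (R : realType) (r : baire)
    (X Y : computableMetricSpace R) (f : X -> Y) : Prop :=
  exists2 F, realizer F f & computable_relative_to r F.

Definition holder_continuous (R : realType) (X Y : metricType R)
    (f : X -> Y) : Prop :=
  exists L a : R, [/\ 0 < L, 0 < a, a <= 1 &
    forall x y, mdist (f x) (f y) <= L * mdist x y `^ a].

(* Main.v *)
Require Import Defs.
From mathcomp Require Import all_boot all_order all_algebra.
From mathcomp Require Import all_classical all_reals all_analysis.
From mathcomp Require Import zify lra.
Set Implicit Arguments.
Unset Strict Implicit.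
Unset Printing Implicit Defensive.

(** If [f] is computable relative to the halting problem [0'], then replacing
    [0'] at stage [s] by "halts within [s] steps" gives a limit computation: a
    one-way machine has read only finitely many oracle values when it writes a
    symbol, and from some stage on the approximations of these are correct.

    Conversely, let a limit machine [M] compute [f].  The constant sequence [j]
    is a Cauchy name of the [j]-th dense point, and [M] on this input is a
    computation without free parameters, so [0'] tells from which time on a
    given block of its output no longer changes.  Hence [0'] computes names of
    the values of [f] at the dense points, uniformly in [j].  If [p] is a name of
    [x], then [f x] is within [L * 2 ^ (- n * a)] of the value at the point with
    index [p n], and [n = c * (k + d)] with [c >= 1 / a] and [2 ^ d >= L] makes
    this at most [2 ^ (- k)].

    The machines are obtained from primitive recursive functions, which are
    computed by register programs, which run on Turing machines. *)

(** Constant names remove the obstacle, because such an input is given by one number [j]. The price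
    is that [f] becomes known on the dense points only, and the way back to an arbitrary [x] takes a
    modulus of continuity that is computable and independent of [x]; this is where Hölder continuity
    enters. Of the reals [L] and [a], computable or not, only integer bounds [c] and [d] go into a
    program, and their existence is enough. A limit machine may produce different names of a value
    on different names of a point; this does no harm, as its output on [j, j, ...] is a name of the
    value in any case. The question put to [0'] is whether a block at time [t] differs from the same
    block at some time [t + s]: a search that halts if and only if the block still changes. *)

Definition upd (T : Type) (f : nat -> T) i x : nat -> T := [eta f with i |-> x].

Lemma updE T (f : nat -> T) i x j : upd f i x j = if j == i then x else f j.
Proof. by []. Qed.

Lemma upd_same (T : Type) (f : nat -> T) i : upd f i (f i) = f.
Proof. by apply/funext => j; rewrite updE; case: eqP => [->|]. Qed.

Lemma upd_upd (T : Type) (f : nat -> T) i x y : upd (upd f i x) i y = upd f i y.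
Proof. by apply/funext => j; rewrite !updE; case: eqP. Qed.

(** * Runs of machines *)

Definition stp (M : machine) (inp : nat -> bool) (c : config) : config :=
  odflt c (step M inp c).

Lemma runD M inp s t : run M inp (s + t) = iter t (stp M inp) (run M inp s).
Proof. by rewrite addnC /run iterD. Qed.

Lemma lookup_cat M N k :
  lookup (M ++ N) k = if lookup M k is Some a then Some a else lookup N k.
Proof.
rewrite /lookup filter_cat map_cat.
by case: [seq e.2 | e <- [seq e <- M | e.1 == k]].
Qed.

Lemma lookup_map (d : scan -> action) (ks : seq scan) k :
  lookup [seq (x, d x) | x <- ks] k = if k \in ks then Some (d k) else None.
Proof.
rewrite /lookup; elim: ks => //= x ks IH; rewrite inE [k == x]eq_sym.
by case: eqP => [->|_].
Qed.

Lemma lookup_state (M : machine) k :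
  k.1.1.1 \notin [seq e.1.1.1.1 | e <- M] -> lookup M k = None.
Proof.
rewrite /lookup; elim: M => //= e M IH; rewrite inE negb_or => /andP[ne /IH].
by case: eqP => // ek; rewrite ek eqxx in ne.
Qed.

(** [P] is required at every step on the way, not only at the ends. For limit machines it will say
    that a given cell already has its final content, which then never changes again; elsewhere it is
    trivially true. *)
Definition reach (P : (nat -> option bool) -> Prop) M inp (c c' : config) :=
  exists k, iter k (stp M inp) c = c' /\
    forall j, j <= k -> P (out (iter j (stp M inp) c)).

Section Reach.
Variables (P : (nat -> option bool) -> Prop) (M : machine) (inp : nat -> bool).
Local Notation reach := (reach P M inp).

Lemma reach_refl c : P (out c) -> reach c c.
Proof. by exists 0; split=> // j; rewrite leqn0 => /eqP ->. Qed.

Lemma reach_trans c1 c2 c3 : reach c1 c2 -> reach c2 c3 -> reach c1 c3.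
Proof.
move=> [k [<- Pk]] [l [<- Pl]]; exists (l + k); split; first by rewrite iterD.
move=> j jle; case: (leqP j k) => [/Pk //|/ltnW kj].
by rewrite -(subnK kj) iterD; apply: Pl; rewrite leq_subLR addnC.
Qed.

Lemma reach_stp c c' : stp M inp c = c' -> P (out c) -> P (out c') -> reach c c'.
Proof.
by move=> <- P0 P1; exists 1; split=> // -[|[|]].
Qed.

End Reach.

(** * Register machines as Turing machines *)

Inductive instr :=
  | IInc of nat | IDec of nat | IJz of nat & nat | IJmp of nat
  | IRead of nat | IOut of bool | ILeft.

Definition instr_reg (i : instr) : nat :=
  match i with IInc r | IDec r | IJz r _ => r | _ => 0 end.

(** A work symbol encodes a column of [K.+1] bits.  Bit 0 marks cell 0, and bit
    [r.+1] says that the cell is below the value of register [r]. *)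
Definition enc (v : seq bool) : nat := (pickle v).+1.
(** The blank 0 decodes to a column of zeros, so a cell never visited lies beyond the value of every
    register. *)
Definition dec (K w : nat) : seq bool :=
  if w is w'.+1 then odflt [::] (unpickle w') else nseq K.+1 false.
Definition syms (K : nat) : seq nat :=
  0 :: [seq enc (val t) | t <- enum {: K.+1.-tuple bool}].

Lemma enc_dec K v : dec K (enc v) = v.
Proof. by rewrite /dec /enc pickleK. Qed.

Lemma mem_enc K v : size v = K.+1 -> enc v \in syms K.
Proof.
move=> /eqP vK; rewrite inE; apply/orP; right; apply/mapP.
by exists (Tuple vK) => //; rewrite mem_enum.
Qed.

Lemma size_dec K w : w \in syms K -> size (dec K w) = K.+1.
Proof.
rewrite inE => /orP[/eqP->|/mapP[t _ ->]]; first by rewrite size_nseq.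
by rewrite enc_dec size_tuple.
Qed.

Lemma mem_set_bit K w r b : w \in syms K -> r <= K ->
  enc (set_nth false (dec K w) r b) \in syms K.
Proof.
move=> /size_dec sw rK; apply: mem_enc; rewrite size_set_nth sw.
by apply/maxn_idPr.
Qed.

Definition tape_regs K (s : nat -> nat) (W : nat -> nat) : Prop :=
  forall n, [/\ W n \in syms K, nth false (dec K (W n)) 0 = (n == 0) &
    forall r, r < K -> nth false (dec K (W n)) r.+1 = (n < s r)].

(** Registers are held in unary, so an increment or decrement changes a single bit: the hypothesis
    on [v] says that the unary forms of [s r] and [v] agree except possibly at cell [n], where the
    new bit is [b]. *)
Lemma tape_regs_set K s W n r b v : tape_regs K s W -> r < K ->
  (forall m, (m < v) = if m == n then b else m < s r) ->
  tape_regs K (upd s r v)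
    (upd W n (enc (set_nth false (dec K (W n)) r.+1 b))).
Proof.
move=> sW rK H m; have [Wm Wm0 Wmr] := sW m; rewrite updE.
case: (eqVneq m n) => [mn|mn].
  rewrite -mn; split; first exact: mem_set_bit.
    by rewrite enc_dec nth_set_nth.
  move=> r' r'K; rewrite enc_dec nth_set_nth /= eqSS updE.
  case: (eqVneq r' r) => [_|_]; last exact: Wmr.
  by rewrite H mn eqxx.
split=> // r' r'K.
rewrite Wmr // updE; case: (eqVneq r' r) => [->|//].
by rewrite H (negbTE mn).
Qed.

(** The phases of instruction [pc] are 0: execute, moving right along a track;
    1: return to cell 0 and go to the next instruction; 2: clear a bit. *)
Definition st (pc ph : nat) : nat := (3 * pc + ph).+1.

Section Flowchart.
Variable code : seq instr.

Definition width : nat := (\max_(r <- map instr_reg code) r).+1.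
Local Notation K := width.

Lemma instr_reg_lt pc : instr_reg (nth ILeft code pc) < K.
Proof.
case: (ltnP pc (size code)) => [lt|ge]; last by rewrite nth_default.
by rewrite ltnS -(nth_map _ 0) // (leq_bigmax_seq _ (mem_nth 0 _)) // size_map.
Qed.

Definition delta (k : scan) : action :=
  let: (q, b, w, o) := k in
  let pc := q.-1 %/ 3 in
  let ph := q.-1 %% 3 in
  let v := dec K w in
  let go s w' m := (s, w', o, (Stay, m, Stay)) in
  if ph == 1 then
    if nth false v 0 then go (st pc.+1 0) w Stay else go (st pc 1) w MoveL
  else if ph == 2 then
    go (st pc 1)
      (enc (set_nth false v (instr_reg (nth ILeft code pc)).+1 false)) Stay
  else match nth ILeft code pc with
  | IInc r => if nth false v r.+1 then go (st pc 0) w MoveR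
              else go (st pc 1) (enc (set_nth false v r.+1 true)) Stay
  | IDec r => if nth false v r.+1 then go (st pc 0) w MoveR
              else go (st pc 2) w MoveL
  | IJz r l => go (st (if nth false v r.+1 then pc.+1 else l) 0) w Stay
  | IJmp l => go (st l 0) w Stay
  | IRead l => (st (if b then pc.+1 else l) 0, w, o, (MoveR, Stay, Stay))
  | IOut c => (st pc.+1 0, w, Some c, (Stay, Stay, MoveR))
  | ILeft => (st pc.+1 0, w, o, (Stay, Stay, MoveL))
  end.

Definition bits : seq bool := [:: true; false].

(** A table is finite, so [delta] is restricted to the states and symbols that can occur. The states
    of address [size code] are left out, which makes the machine halt when it gets there. *)
Definition keys : seq scan :=
  [seq (x, o) | x <- [seq (y, w) | y <- [seq (q, b) | q <- iota 1 (3 * size code),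
     b <- bits], w <- syms K], o <- [:: None; Some true; Some false]].

Definition table : machine := [seq (k, delta k) | k <- keys].

(** [tm c] first writes [c.+1] into register 0.  As this takes a chain of states
    rather than the input tape, the machine for the parameter [c] runs on blank
    input, as the halting problem requires. *)
Definition ramp_state (i : nat) : nat := 3 * size code + 4 + i.
Definition mark : nat := enc [:: true, true & nseq K.-1 false].
Definition unit1 : nat := enc [:: false, true & nseq K.-1 false].

Definition boot c : machine :=
  [seq ((0, b, 0, None),
        (ramp_state c, mark, None, (Stay, MoveR, Stay))) | b <- bits].
Definition ramp_last : machine :=
  [seq ((ramp_state 0, b, 0, None),
        (st 0 1, 0, None, (Stay, MoveL, Stay))) | b <- bits].
Definition ramp_entry i : machine :=
  [seq ((ramp_state i.+1, b, 0, None),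
        (ramp_state i, unit1, None, (Stay, MoveR, Stay))) | b <- bits].
(** The recursion is a bare [nat_rect] to fit [pr_rec]: the table must depend on [c] in a primitive
    recursive way. *)
Definition ramp (c : nat) : machine :=
  nat_rect _ (ramp_last ++ table) (fun i M => ramp_entry i ++ M) c.
Definition tm c : machine := boot c ++ ramp c.

Lemma ramp0 : ramp 0 = ramp_last ++ table. Proof. by []. Qed.
Lemma rampS i : ramp i.+1 = ramp_entry i ++ ramp i. Proof. by []. Qed.

Lemma ramp_state_gt0 i : 0 < ramp_state i.
Proof. by rewrite /ramp_state addnAC addn_gt0 orbT. Qed.

Lemma mem_keys q b w o : 0 < q <= 3 * size code -> w \in syms K ->
  (q, b, w, o) \in keys.
Proof.
move=> hq hw; apply: allpairs_f; last by case: o => [[]|]; rewrite !inE.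
apply: allpairs_f => //; apply: allpairs_f; last by case: b.
by rewrite mem_iota add1n ltnS.
Qed.

Lemma keys_state k : k \in keys -> 0 < k.1.1.1 <= 3 * size code.
Proof.
move=> /allpairsP[[x o] [/allpairsP[[y w] [/allpairsP[[q b] /= [+ _ ->]] _ ->]] _ ->]] /=.
by rewrite mem_iota add1n ltnS.
Qed.

Lemma lookup_table k : k \in keys -> lookup table k = Some (delta k).
Proof. by move=> kin; rewrite /table lookup_map kin. Qed.

Lemma lookup_ramp c q b w o : q < ramp_state 0 ->
  lookup (ramp c) (q, b, w, o) = lookup table (q, b, w, o).
Proof.
move=> qlt; elim: c => [|c IH]; rewrite (ramp0, rampS) lookup_cat lookup_state //=.
  by rewrite !inE orbb neq_ltn qlt.
by rewrite !inE orbb neq_ltn (leq_trans qlt) // leq_add2l.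
Qed.

Lemma lookup_ramp_last c b : lookup (ramp c) (ramp_state 0, b, 0, None) =
  Some (st 0 1, 0, None, (Stay, MoveL, Stay)).
Proof.
elim: c => [|c IH]; rewrite (ramp0, rampS) lookup_cat.
  by case: b; rewrite /lookup /= !xpair_eqE !eqxx.
by rewrite lookup_state //= !inE orbb eqn_add2l.
Qed.

Lemma lookup_ramp_entry c i b : i < c ->
  lookup (ramp c) (ramp_state i.+1, b, 0, None) =
  Some (ramp_state i, unit1, None, (Stay, MoveR, Stay)).
Proof.
elim: c => // c IH; rewrite ltnS leq_eqVlt rampS lookup_cat => /orP[/eqP->|ic].
  by case: b {IH}; rewrite /lookup /= !xpair_eqE !eqxx.
by rewrite lookup_state ?IH //= !inE orbb eqn_add2l eqSS neq_ltn ic.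
Qed.

Lemma lookup_tm c q b w o : 0 < q -> lookup (tm c) (q, b, w, o) = lookup (ramp c) (q, b, w, o).
Proof.
by move=> q0; rewrite lookup_cat lookup_state //= !inE orbb -lt0n.
Qed.

Lemma lookup_boot c b : lookup (tm c) (0, b, 0, None) =
  Some (ramp_state c, mark, None, (Stay, MoveR, Stay)).
Proof.
by rewrite lookup_cat; case: b.
Qed.

Lemma lookup_tm_st c pc ph b w o : pc < size code -> ph < 3 -> w \in syms K ->
  lookup (tm c) (st pc ph, b, w, o) = Some (delta (st pc ph, b, w, o)).
Proof.
move=> hpc hph hw; have lt : st pc ph <= 3 * size code.
  have : 3 * pc.+1 <= 3 * size code by rewrite leq_mul2l.
  by apply: leq_trans; rewrite /st mulnS addnC -addSn leq_add2r.
rewrite lookup_tm // lookup_ramp ?lookup_table ?mem_keys //.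
by rewrite /ramp_state (leq_ltn_trans lt) // addn0 -[ltnLHS]addn0 ltn_add2l.
Qed.

Lemma lookup_tm_end c b w o : lookup (tm c) (st (size code) 0, b, w, o) = None.
Proof.
rewrite lookup_tm // lookup_ramp; last by rewrite /st /ramp_state !addn0 -addn1 ltn_add2l.
apply: lookup_state; apply/mapP => -[e /mapP[k /keys_state kk -> /=] ek].
by move: kk; rewrite -ek /st addn0 ltnn andbF.
Qed.

Lemma st_pc pc ph : ph < 3 -> (st pc ph).-1 %/ 3 = pc.
Proof. by move=> h; rewrite /= mulnC divnMDl // divn_small // addn0. Qed.
Lemma st_ph pc ph : ph < 3 -> (st pc ph).-1 %% 3 = ph.
Proof. by move=> h; rewrite /= mulnC modnMDl modn_small. Qed.

Definition apply_action (x : config) (a : action) : config :=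
  let: (q, w, o, (mi, mw, mo)) := a in
  Config q (Defs.shift mi (in_pos x)) (upd (work x) (work_pos x) w)
    (Defs.shift mw (work_pos x)) (upd (out x) (out_pos x) o)
    (Defs.shift mo (out_pos x)).

Lemma stepE M inp (x : config) a :
  lookup M (state x, inp (in_pos x), work x (work_pos x), out x (out_pos x)) = Some a ->
  step M inp x = Some (apply_action x a).
Proof. by rewrite /step => ->; case: a => [[[q w] o] [[mi mw] mo]]. Qed.

Lemma stpE M inp (x : config) a :
  lookup M (state x, inp (in_pos x), work x (work_pos x), out x (out_pos x)) = Some a ->
  stp M inp x = apply_action x a.
Proof. by rewrite /stp => /stepE ->. Qed.

(** Input and output of a register machine are those of the Turing machine. *)
Record memory := Memory {
  regs : nat -> nat; ipos : nat; outp : nat -> option bool; opos : nat }.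

Definition represents pc (m : memory) (x : config) : Prop :=
  exists2 W, tape_regs K (regs m) W &
    x = Config (st pc 0) (ipos m) W 0 (outp m) (opos m).

Section Simulation.
Variables (P : (nat -> option bool) -> Prop) (c : nat) (inp : nat -> bool).
Local Notation reaches := (reach P (tm c) inp).

Lemma stp_st pc ph ip W wp o op : pc < size code -> ph < 3 -> W wp \in syms K ->
  stp (tm c) inp (Config (st pc ph) ip W wp o op) =
  apply_action (Config (st pc ph) ip W wp o op)
    (delta (st pc ph, inp ip, W wp, o op)).
Proof. by move=> hpc hph hw; apply: stpE; apply: lookup_tm_st. Qed.

Section Instruction.
Variables (pc : nat).
Hypothesis pc_lt : pc < size code.

Lemma go_right s r ip W o op i :
  (nth ILeft code pc = IInc r \/ nth ILeft code pc = IDec r) ->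
  tape_regs K s W -> i <= s r -> P o ->
  reaches (Config (st pc 0) ip W 0 o op) (Config (st pc 0) ip W i o op).
Proof.
move=> Hr sW + Po; elim: i => [|i IH] his; first exact: reach_refl.
apply: reach_trans (IH (ltnW his)) _; apply: reach_stp => //.
have [Wi _ /(_ r) Wr] := sW i.
have rK : r < K by have := instr_reg_lt pc; case: Hr => ->.
rewrite stp_st // /delta st_pc // st_ph //=.
by case: Hr => -> /=; rewrite Wr // his /apply_action /= !upd_same.
Qed.

Lemma go_left s ip W o op i : tape_regs K s W -> P o ->
  reaches (Config (st pc 1) ip W i o op) (Config (st pc.+1 0) ip W 0 o op).
Proof.
move=> sW Po; elim: i => [|i IH]; [|apply: reach_trans IH]; apply: reach_stp => //.
  have [Wi W0 _] := sW 0.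
  by rewrite stp_st // /delta st_pc // st_ph //= W0 /apply_action /= !upd_same.
have [Wi W0 _] := sW i.+1.
by rewrite stp_st // /delta st_pc // st_ph //= W0 /apply_action /= !upd_same.
Qed.

Definition simulates m pc' m' := forall x, represents pc m x ->
  exists2 x', represents pc' m' x' & reaches x x'.

Lemma sim_inc s ip o op r : nth ILeft code pc = IInc r -> P o ->
  simulates (Memory s ip o op) pc.+1 (Memory (upd s r (s r).+1) ip o op).
Proof.
move=> I Po x [W /= sW ->].
have rK : r < K by have := instr_reg_lt pc; rewrite I.
have sW' : tape_regs K (upd s r (s r).+1)
    (upd W (s r) (enc (set_nth false (dec K (W (s r))) r.+1 true))).
  by apply: tape_regs_set => // m; rewrite ltnS leq_eqVlt; case: eqP.
eexists; first by eexists; [exact: sW'|reflexivity].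
apply: reach_trans (go_right _ _ (or_introl I) sW (leqnn _) Po) _.
apply: reach_trans (go_left _ _ (s r) sW' Po); apply: reach_stp => //=.
have [Wi _ /(_ r rK) Wr] := sW (s r).
rewrite stp_st // /delta st_pc // st_ph //= I Wr ltnn.
by rewrite /apply_action /= !upd_same.
Qed.

(** The value 0 needs no machinery of its own: the left move from cell 0 has no effect, and the bit
    cleared there is 0 already. *)
Lemma sim_dec s ip o op r : nth ILeft code pc = IDec r -> P o ->
  simulates (Memory s ip o op) pc.+1 (Memory (upd s r (s r).-1) ip o op).
Proof.
move=> I Po x [W /= sW ->].
have rK : r < K by have := instr_reg_lt pc; rewrite I.
have sW' : tape_regs K (upd s r (s r).-1)
    (upd W (s r).-1 (enc (set_nth false (dec K (W (s r).-1)) r.+1 false))).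
  apply: tape_regs_set => // m; case: (s r) => [|n] /=; first by case: eqP.
  by case: eqP => [->|/eqP mn]; rewrite ?ltnn // ltnS ltn_neqAle mn.
eexists; first by eexists; [exact: sW'|reflexivity].
apply: reach_trans (go_right _ _ (or_intror I) sW (leqnn _) Po) _.
apply: reach_trans (go_left _ _ (s r).-1 sW' Po).
apply: (@reach_trans _ _ _ _ (Config (st pc 2) ip W (s r).-1 o op)).
  apply: reach_stp => //=.
  have [Wi _ /(_ r rK) Wr] := sW (s r).
  rewrite stp_st // /delta st_pc // st_ph //= I Wr ltnn.
  by rewrite /apply_action /= !upd_same.
apply: reach_stp => //=.
have [Wi _ /(_ r rK) Wr] := sW (s r).-1.
rewrite stp_st // /delta st_pc // st_ph //= I /=.
by rewrite /apply_action /= !upd_same.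
Qed.

Lemma sim_simple m pc' m' I : nth ILeft code pc = I -> P (outp m) -> P (outp m') ->
  regs m' = regs m ->
  (forall W, tape_regs K (regs m) W ->
    apply_action (Config (st pc 0) (ipos m) W 0 (outp m) (opos m))
      (delta (st pc 0, inp (ipos m), W 0, outp m (opos m))) =
    Config (st pc' 0) (ipos m') W 0 (outp m') (opos m')) ->
  simulates m pc' m'.
Proof.
move=> I_pc Po Po' em H x [W sW ->]; eexists.
  by exists W; [rewrite em; exact: sW|reflexivity].
apply: reach_stp => //; have [Wi _ _] := sW 0.
by rewrite stp_st // H.
Qed.

Lemma sim_jz s ip o op r l : nth ILeft code pc = IJz r l -> P o ->
  simulates (Memory s ip o op) (if s r == 0 then l else pc.+1) (Memory s ip o op).
Proof.
move=> I Po; apply: (sim_simple I) => //= W sW.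
have rK : r < K by have := instr_reg_lt pc; rewrite I.
have [Wi _ /(_ r rK) Wr] := sW 0.
rewrite /delta st_pc // st_ph //= I Wr /apply_action /= !upd_same lt0n.
by case: eqP.
Qed.

Lemma sim_jmp m l : nth ILeft code pc = IJmp l -> P (outp m) -> simulates m l m.
Proof.
move=> I Po; apply: (sim_simple I) => //= W sW.
by rewrite /delta st_pc // st_ph //= I /apply_action /= !upd_same.
Qed.

Lemma sim_read s ip o op l : nth ILeft code pc = IRead l -> P o ->
  simulates (Memory s ip o op) (if inp ip then pc.+1 else l) (Memory s ip.+1 o op).
Proof.
move=> I Po; apply: (sim_simple I) => //= W sW.
by rewrite /delta st_pc // st_ph //= I /apply_action /= !upd_same.
Qed.

Lemma sim_out s ip o op b : nth ILeft code pc = IOut b ->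
  P o -> P (upd o op (Some b)) ->
  simulates (Memory s ip o op) pc.+1 (Memory s ip (upd o op (Some b)) op.+1).
Proof.
move=> I Po Po'; apply: (sim_simple I) => //= W sW.
by rewrite /delta st_pc // st_ph //= I /apply_action /= !upd_same.
Qed.

Lemma sim_left s ip o op : nth ILeft code pc = ILeft -> P o ->
  simulates (Memory s ip o op) pc.+1 (Memory s ip o op.-1).
Proof.
move=> I Po; apply: (sim_simple I) => //= W sW.
by rewrite /delta st_pc // st_ph //= I /apply_action /= !upd_same.
Qed.

End Instruction.

Lemma sim_trans pc1 m1 pc2 m2 pc3 m3 :
  simulates pc1 m1 pc2 m2 -> simulates pc2 m2 pc3 m3 -> simulates pc1 m1 pc3 m3.
Proof.
move=> H1 H2 x /H1[y /H2[z rz yz] xy]; exists z => //; exact: reach_trans xy yz.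
Qed.

Definition start_memory : memory := Memory (upd (fun=> 0) 0 c.+1) 0 (fun=> None) 0.

(** The boot chain ends in the return phase of instruction 0, so execution goes on at address 1;
    this is why programs are compiled from address 1, behind a dummy [IJmp 0] that is never
    executed. As register 0 holds [c.+1], it is nonzero and can guard a loop without end. *)
Lemma tm_start : 0 < size code -> P (fun=> None) ->
  exists2 x, represents 1 start_memory x & reaches init x.
Proof.
move=> code0 P0.
pose W i n := if n < i then if n == 0 then mark else unit1 else 0.
have updW i : upd (W i) i (if i == 0 then mark else unit1) = W i.+1.
  apply/funext => n; rewrite updE /W ltnS [n <= i]leq_eqVlt.
  by case: (eqVneq n i) => [->|].
have W0 n : W n n = 0 by rewrite /W ltnn.
have sW : tape_regs K (upd (fun=> 0) 0 c.+1) (W c.+1).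
  move=> n; rewrite /W; case: (ltnP n c.+1) => nc; last first.
    split=> [||r rK].
    - by rewrite inE.
    - by case: n nc.
    rewrite /dec nth_nseq if_same updE; case: (r == 0) => //.
    by rewrite ltnNge nc.
  have sz b : size [:: b, true & nseq K.-1 false] = K.+1 by rewrite /= size_nseq.
  case: eqP => [->|/eqP n0]; rewrite enc_dec; split=> //; try exact: mem_enc.
    by case=> // r rK; rewrite /= nth_nseq if_same.
  case=> [|r] rK; first by rewrite /= nc.
  by rewrite /= nth_nseq if_same.
eexists; first by exists (W c.+1); [exact: sW|reflexivity].
have step0 i : i <= c -> reaches init
    (Config (ramp_state (c - i)) 0 (W i.+1) i.+1 (fun=> None) 0).
  elim: i => [_|i IH ic].
    apply: reach_stp => //; rewrite (@stpE _ _ init _ (lookup_boot _ _)) subn0.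
    by rewrite /apply_action /= upd_same -updW.
  apply: reach_trans (IH (ltnW ic)) _; apply: reach_stp => //.
  rewrite (@stpE _ _ _ (ramp_state (c - i.+1), unit1, None, (Stay, MoveR, Stay))) /=.
    by rewrite /apply_action /= upd_same -[in RHS]updW.
  rewrite W0 -(subnSK ic) lookup_tm ?ramp_state_gt0 //.
  by apply: lookup_ramp_entry; rewrite ltn_subrL (leq_ltn_trans _ ic).
apply: reach_trans (step0 c (leqnn c)) _.
apply: reach_trans (go_left code0 0 0 c sW P0); apply: reach_stp => //.
rewrite subnn (@stpE _ _ _ (st 0 1, 0, None, (Stay, MoveL, Stay))) /=.
  by rewrite /apply_action /= upd_same -[X in upd (W _) _ X](W0 c.+1) upd_same.
by rewrite W0 lookup_tm ?ramp_state_gt0 //; apply: lookup_ramp_last.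
Qed.

End Simulation.
End Flowchart.

(** * Structured register programs *)

Inductive prog :=
  | PInc of nat | PDec of nat | PRead of nat | POut of bool | PLeft
  | PSeq of prog & prog | PWhile of nat & prog.

Declare Scope prog_scope.
Delimit Scope prog_scope with P.
Notation "p ;; q" := (PSeq p q) (at level 60, right associativity) : prog_scope.
Local Open Scope prog_scope.

(** Jump targets are absolute, and [b] is the address of the first instruction. *)
Fixpoint compile (b : nat) (p : prog) : seq instr :=
  match p with
  | PInc r => [:: IInc r]
  | PDec r => [:: IDec r]
  | PRead r => [:: IRead (b + 2); IInc r]
  | POut a => [:: IOut a]
  | PLeft => [:: ILeft]
  | p ;; q => let l := compile b p in l ++ compile (b + size l) q
  | PWhile r p => let l := compile b.+1 p in
      IJz r (b + (size l).+2) :: l ++ [:: IJmp b]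
  end.

Fixpoint right_only (p : prog) : bool :=
  match p with
  | PLeft => false
  | p ;; q => right_only p && right_only q
  | PWhile _ p => right_only p
  | _ => true
  end.

Section Exec.
Variables (P : (nat -> option bool) -> Prop) (inp : nat -> bool).

(** Big-step semantics of terminating runs. [P] is demanded after an output only, as no other
    instruction writes on the output tape. *)
Inductive exec : prog -> memory -> memory -> Prop :=
  | XInc s i o a r : exec (PInc r) (Memory s i o a) (Memory (upd s r (s r).+1) i o a)
  | XDec s i o a r : exec (PDec r) (Memory s i o a) (Memory (upd s r (s r).-1) i o a)
  | XRead s i o a r :
      exec (PRead r) (Memory s i o a) (Memory (upd s r (inp i + s r)) i.+1 o a)
  | XOut s i o a b : P (upd o a (Some b)) ->
      exec (POut b) (Memory s i o a) (Memory s i (upd o a (Some b)) a.+1)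
  | XLeft s i o a : exec PLeft (Memory s i o a) (Memory s i o a.-1)
  | XSeq p q m1 m2 m3 : exec p m1 m2 -> exec q m2 m3 -> exec (p ;; q) m1 m3
  | XDone r p m : regs m r = 0 -> exec (PWhile r p) m m
  | XLoop r p m1 m2 m3 : regs m1 r <> 0 -> exec p m1 m2 ->
      exec (PWhile r p) m2 m3 -> exec (PWhile r p) m1 m3.

Lemma exec_out p m m' : exec p m m' -> P (outp m) -> P (outp m').
Proof. by elim=> //=; auto. Qed.

Lemma exec_for (I : nat -> memory -> Prop) r p :
  (forall m, I 0 m -> regs m r = 0) ->
  (forall n m, I n.+1 m -> regs m r <> 0 /\ exists2 m', exec p m m' & I n m') ->
  forall n m, I n m -> exists2 m', exec (PWhile r p) m m' & I 0 m'.
Proof.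
move=> I0 IS; elim=> [|n IH] m Im; first by exists m => //; apply/XDone/I0.
have [mr [m2 pm Im2]] := IS _ _ Im; have [m3 qm Im3] := IH _ Im2.
by exists m3 => //; apply: XLoop pm qm.
Qed.

Variables (code : seq instr) (c : nat).
Local Notation simulates := (simulates code P c inp).

Definition code_at b (l : seq instr) : Prop :=
  exists pre post, code = pre ++ l ++ post /\ size pre = b.

Lemma code_at_cat b l1 l2 : code_at b (l1 ++ l2) ->
  code_at b l1 /\ code_at (b + size l1) l2.
Proof.
move=> [pre [post [e <-]]]; split.
  by exists pre, (l2 ++ post); rewrite e -catA.
by exists (pre ++ l1), post; rewrite e size_cat !catA.
Qed.

Lemma code_at_head b i l : code_at b (i :: l) ->
  [/\ b < size code, nth ILeft code b = i & code_at b.+1 l].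
Proof.
move=> [pre [post [e <-]]]; split.
- by rewrite e size_cat /= addnS ltnS leq_addr.
- by rewrite e nth_cat ltnn subnn.
- by exists (rcons pre i), post; rewrite e cat_rcons size_rcons.
Qed.

Lemma sim_while_test r p b m : code_at b (compile b (PWhile r p)) -> P (outp m) ->
  simulates b m (if regs m r == 0 then b + size (compile b (PWhile r p)) else b.+1) m.
Proof.
case: m => s i o a /code_at_head[lt e _] /= Po.
have := sim_jz c inp lt e Po; rewrite /= size_cat /= addn1; exact.
Qed.

Lemma compile_correct p m m' : exec p m m' ->
  forall b, code_at b (compile b p) -> P (outp m) ->
  simulates b m (b + size (compile b p)) m'.
Proof.
elim=> {p m m'}.
- by move=> s i o a r b /code_at_head[lt e _] Po; rewrite addn1; apply: sim_inc.
- by move=> s i o a r b /code_at_head[lt e _] Po; rewrite addn1; apply: sim_dec.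
- move=> s i o a r b /code_at_head[lt e /code_at_head[lt' e' _]] Po.
  have := @sim_read code P c inp b lt s i o a _ e Po.
  rewrite /= addn2; case: (inp i) => H.
    by apply: sim_trans H _; rewrite add1n; apply: sim_inc.
  by rewrite upd_same.
- by move=> s i o a x Po' b /code_at_head[lt e _] Po; rewrite addn1; apply: sim_out.
- by move=> s i o a b /code_at_head[lt e _] Po; rewrite addn1; apply: sim_left.
- move=> p q m1 m2 m3 pm IHp _ IHq b /code_at_cat[Hp Hq] Po.
  rewrite /= size_cat addnA; apply: sim_trans (IHp _ Hp Po) (IHq _ Hq _).
  exact: exec_out pm Po.
- move=> r p m mr b Hb Po; have := sim_while_test Hb Po.
  by rewrite mr eqxx.
- move=> r p m1 m2 m3 /eqP/negbTE mr pm IHp _ IHw b Hb Po.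
  have [lt e /code_at_cat[Hp /code_at_head[lt' e' _]]] := code_at_head Hb.
  have Po2 := exec_out pm Po.
  apply: sim_trans (IHw b Hb Po2).
  have := sim_while_test Hb Po; rewrite mr => H; apply: sim_trans H _.
  by apply: sim_trans (IHp _ Hp Po) _; apply: sim_jmp e' Po2.
Qed.

(** Loops without end have no derivation in [exec], so their rounds are followed one by one with an
    invariant indexed by the round. The loop test takes a step in each round, hence [i <= k], and
    arbitrarily late times are covered. *)
Lemma exec_forever r p b (I : nat -> memory -> Prop) m0 x :
  code_at b (compile b (PWhile r p)) ->
  (forall i m, I i m -> regs m r <> 0 /\ exists2 m', exec p m m' & I i.+1 m') ->
  P (outp m0) -> I 0 m0 -> represents code b m0 x ->
  forall i, exists2 k, i <= k &
    (exists2 m, I i m & represents code b m (iter k (stp (tm code c) inp) x)) /\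
    forall j, j <= k -> P (out (iter j (stp (tm code c) inp) x)).
Proof.
move=> Hb H P0 I0 x0.
have [lt e /code_at_cat[Hp /code_at_head[lt' e' _]]] := code_at_head Hb.
elim=> [|i [k ik [[m Im rm] Pk]]].
  exists 0 => //; split; first by exists m0.
  by move=> j; rewrite leqn0 => /eqP->; have [W _ ->] := x0.
have [/eqP/negbTE mr [m' em Im']] := H _ _ Im.
have Pm : P (outp m) by have := Pk k (leqnn k); have [W _ ->] := rm.
set y := iter k _ x in rm; have [W sW ey] := rm.
have [y1 ry1 ey1] : exists2 y1, represents code b.+1 m y1 & stp (tm code c) inp y = y1.
  have rK : r < width code by have := instr_reg_lt code b; rewrite e.
  have [W0 _ /(_ r rK) Wr] := sW 0.
  eexists; last by rewrite ey stp_st.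
  exists W => //; rewrite /delta st_pc // st_ph //= e Wr lt0n mr /=.
  by rewrite /apply_action /= !upd_same.
have [y2 ry2 y12] := compile_correct em Hp Pm ry1.
have [y3 ry3 y23] := sim_jmp c inp lt' e' (exec_out em Pm) ry2.
have [l [el Pl]] := reach_trans y12 y23.
exists (l + k.+1); first by rewrite addnS ltnS (leq_trans ik) ?leq_addl.
split; first by exists m' => //; rewrite iterD iterS -/y ey1 el.
move=> j; case: (leqP j k) => [/Pk //|kj jle].
by rewrite -(subnK kj) iterD iterS -/y ey1; apply: Pl; rewrite leq_subLR addnC.
Qed.

End Exec.

Ltac updlia := rewrite ?updE; repeat (case: eqP => ? ); try lia.

(** * Primitive recursive terms *)

(** Variables are de Bruijn indices, and [TLet] takes the place of composition, so terms need no
    arities. In the step of [TRec], index 0 is the counter and index 1 the previous value. *)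
Inductive term :=
  | TVar of nat | TZero | TSucc of term | TLet of term & term
  | TRec of term & term & term.

Definition scons (x : nat) (e : nat -> nat) (i : nat) : nat :=
  if i is j.+1 then e j else x.

Fixpoint teval (t : term) (e : nat -> nat) : nat :=
  match t with
  | TVar i => e i
  | TZero => 0
  | TSucc t => (teval t e).+1
  | TLet t u => teval u (scons (teval t e) e)
  | TRec n b s => nat_rec (fun=> nat) (teval b e)
      (fun i a => teval s (scons i (scons a e))) (teval n e)
  end.

Definition clear r := PWhile r (PDec r).
Definition move_reg r r' := PWhile r (PDec r ;; PInc r').
(** Reading a register by a loop empties it, so its value goes to [d] and [d.+1] together and is
    restored from [d.+1]. *)
Definition copy_reg r d := clear d ;; clear d.+1 ;;
  PWhile r (PDec r ;; PInc d ;; PInc d.+1) ;; move_reg d.+1 r.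

(** Puts the value of a term into register [d]; variable [i] is held by register
    [rho i], and all registers below [d] are preserved. *)
Fixpoint prog_of (rho : nat -> nat) (d : nat) (t : term) : prog :=
  match t with
  | TVar i => copy_reg (rho i) d
  | TZero => clear d
  | TSucc t => prog_of rho d t ;; PInc d
  | TLet t u => prog_of rho d t ;; prog_of (scons d rho) d.+1 u ;;
      clear d ;; move_reg d.+1 d
  | TRec n b s => prog_of rho d n ;; prog_of rho d.+1 b ;; clear d.+2 ;;
      PWhile d (PDec d ;; prog_of (scons d.+2 (scons d.+1 rho)) d.+3 s ;;
        clear d.+1 ;; move_reg d.+3 d.+1 ;; PInc d.+2) ;;
      move_reg d.+1 d
  end.

Lemma right_only_prog_of rho d t : right_only (prog_of rho d t).
Proof.
elim: t rho d => //= [t IH|t IHt u IHu|n IHn b IHb s IHs] rho d.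
- by rewrite IH.
- by rewrite IHt IHu.
- by rewrite IHn IHb IHs.
Qed.

Section Runs.
Variables (P : (nat -> option bool) -> Prop) (inp : nat -> bool).

Definition runs p s s' := forall i o a,
  exec P inp p (Memory s i o a) (Memory s' i o a).

Lemma runs_seq p q s1 s2 s3 : runs p s1 s2 -> runs q s2 s3 -> runs (p ;; q) s1 s3.
Proof. by move=> H1 H2 i o a; apply: XSeq (H1 i o a) (H2 i o a). Qed.

Lemma runs_inc r s : runs (PInc r) s (upd s r (s r).+1).
Proof. by move=> i o a; apply: XInc. Qed.

Lemma runs_dec r s : runs (PDec r) s (upd s r (s r).-1).
Proof. by move=> i o a; apply: XDec. Qed.

Lemma runs_done r p s : s r = 0 -> runs (PWhile r p) s s.
Proof. by move=> sr i o a; apply: XDone. Qed.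

Lemma runs_loop r p s1 s2 s3 : s1 r <> 0 -> runs p s1 s2 ->
  runs (PWhile r p) s2 s3 -> runs (PWhile r p) s1 s3.
Proof.
move=> sr H1 H2 i o a.
exact: (@XLoop P inp r p (Memory s1 i o a) _ _ sr (H1 i o a) (H2 i o a)).
Qed.

Lemma runs_clear r s : runs (clear r) s (upd s r 0).
Proof.
move e: (s r) => n; elim: n s e => [|n IH] s e.
  by rewrite -e upd_same; apply: runs_done.
apply: runs_loop (runs_dec _ _) _; first by rewrite e.
by rewrite -(upd_upd s r (s r).-1 0); apply: IH; rewrite updE eqxx e.
Qed.

Lemma runs_move r r' s : r != r' ->
  runs (move_reg r r') s (upd (upd s r' (s r + s r')) r 0).
Proof.
move=> rr'; move e: (s r) => n; elim: n s e => [|n IH] s e.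
  by rewrite add0n upd_same -e upd_same; apply: runs_done.
apply: runs_loop; first by rewrite e.
  by apply: runs_seq; [exact: runs_dec|exact: runs_inc].
set t := upd (upd _ _ _) _ _.
have -> : upd (upd s r' (n.+1 + s r')) r 0 = upd (upd t r' (n + t r')) r 0.
  by apply/funext => j; rewrite /t; updlia.
by apply: IH; rewrite /t; updlia.
Qed.

Lemma runs_copy r d s : r < d -> exists2 s', runs (copy_reg r d) s s' &
  s' d = s r /\ forall j, j < d -> s' j = s j.
Proof.
move=> rd.
have L n s1 : s1 r = n -> exists2 s2,
    runs (PWhile r (PDec r ;; PInc d ;; PInc d.+1)) s1 s2 &
    [/\ s2 r = 0, s2 d = n + s1 d, s2 d.+1 = n + s1 d.+1 &
      forall j, j < d -> j != r -> s2 j = s1 j].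
  elim: n s1 => [|n IH] s1 e; first by exists s1 => //; apply: runs_done.
  have [|s2 H2 [h1 h2 h3 h4]] :=
    IH (upd (upd (upd s1 r (s1 r).-1) d (s1 d).+1) d.+1 (s1 d.+1).+1).
    by updlia.
  exists s2.
    apply: runs_loop H2; first by rewrite e.
    apply: runs_seq (runs_dec _ _) _; apply: runs_seq (runs_inc _ _) _.
    set t := upd (upd _ _ _) d _.
    have -> : upd (upd (upd s1 r (s1 r).-1) d (s1 d).+1) d.+1 (s1 d.+1).+1 =
        upd t d.+1 (t d.+1).+1; last exact: runs_inc.
    by apply/funext => j; rewrite /t; updlia.
  split=> //; first by rewrite h2; updlia.
    by rewrite h3; updlia.
  by move=> j jd jr; rewrite h4 //; updlia.
have [s2 H2 [h1 h2 h3 h4]] := L _ (upd (upd s d 0) d.+1 0) (erefl _).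
exists (upd (upd s2 r (s2 d.+1 + s2 r)) d.+1 0).
  apply: runs_seq (runs_clear _ _) _; apply: runs_seq (runs_clear _ _) _.
  by apply: runs_seq H2 _; apply: runs_move; lia.
split.
  by updlia; rewrite h2; updlia.
move=> j jd; updlia; first by subst j; rewrite h1 h3; updlia.
by rewrite h4 //; updlia.
Qed.

Lemma runs_term t rho d s : (forall i, rho i < d) ->
  exists2 s', runs (prog_of rho d t) s s' &
    s' d = teval t (s \o rho) /\ forall j, j < d -> s' j = s j.
Proof.
elim: t rho d s => [i||t IH|t IHt u IHu|n IHn b IHb q IHq] rho d s Hr /=.
- exact: runs_copy.
- exists (upd s d 0); first exact: runs_clear.
  by split=> [|j jd]; updlia.
- have [s1 H1 [e1 p1]] := IH rho d s Hr.
  exists (upd s1 d (s1 d).+1); first by apply: runs_seq H1 (runs_inc _ _).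
  by rewrite -e1; split=> [|j jd]; updlia; apply: p1.
- have [s1 H1 [e1 p1]] := IHt rho d s Hr.
  have [|s2 H2 [e2 p2]] := IHu (scons d rho) d.+1 s1.
    by case=> //= i; rewrite ltnW // ltnS.
  exists (upd (upd (upd s2 d 0) d (s2 d.+1)) d.+1 0).
    apply: runs_seq H1 _; apply: runs_seq H2 _; apply: runs_seq (runs_clear _ _) _.
    have := @runs_move d.+1 d (upd s2 d 0) (_ : d.+1 != d).
    have -> : upd s2 d 0 d.+1 + upd s2 d 0 d = s2 d.+1 by updlia.
    by apply; lia.
  split; last by move=> j jd; updlia; rewrite p2 ?p1 //; lia.
  updlia; rewrite e2; congr teval.
  by apply/funext => -[|i] /=; [exact: e1|rewrite p1].
have [s1 H1 [e1 p1]] := IHn rho d s Hr.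
have [|s2 H2 [e2 p2]] := IHb rho d.+1 s1; first by move=> i; rewrite ltnW // ltnS.
have es1 : s1 \o rho = s \o rho by apply/funext => i /=; rewrite p1.
rewrite es1 in e2.
set V := nat_rec _ _ _.
(* Invariant of the loop: [d] counts the rounds left, [d.+2] the rounds done, and [d.+1] holds the
   value of the recursion reached. *)
have L k j s3 : s3 d = k -> s3 d.+2 = j -> s3 d.+1 = V j ->
    (forall i, i < d -> s3 i = s i) -> exists2 s4,
    runs (PWhile d (PDec d ;; prog_of (scons d.+2 (scons d.+1 rho)) d.+3 q ;;
        clear d.+1 ;; move_reg d.+3 d.+1 ;; PInc d.+2)) s3 s4 &
    [/\ s4 d = 0, s4 d.+1 = V (k + j) & forall i, i < d -> s4 i = s i].
  elim: k j s3 => [|k IH] j s3 d0 d2 d1 pd.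
    by exists s3; [apply: runs_done|split].
  have [|s4 H4 [e4 p4]] := IHq (scons d.+2 (scons d.+1 rho)) d.+3 (upd s3 d k).
    by case=> [|[|i]] //=; have := Hr i; lia.
  have E4 : s4 d.+3 = V j.+1.
    rewrite e4 /V /=; congr teval; apply/funext => -[|[|i]] /=; try by updlia.
    by have := Hr i; updlia => _; apply: pd.
  have [p40 p42] : s4 d = k /\ s4 d.+2 = j by rewrite !p4; try lia; split; updlia.
  pose s5 := upd (upd (upd s4 d.+1 (V j.+1)) d.+3 0) d.+2 j.+1.
  have [||||s6 H6 [h1 h2 h3]] := IH j.+1 s5; try by rewrite /s5; updlia.
    by move=> i id; rewrite /s5; updlia; rewrite p4; updlia; apply: pd.
  exists s6; last by split=> //; rewrite addSnnS.
  apply: runs_loop H6; first by rewrite d0.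
  apply: runs_seq (runs_dec _ _) _; rewrite d0; apply: runs_seq H4 _.
  apply: runs_seq (runs_clear _ _) _.
  apply: (@runs_seq _ _ _ (upd (upd s4 d.+1 (V j.+1)) d.+3 0)).
    have := @runs_move d.+3 d.+1 (upd s4 d.+1 0).
    have -> : upd s4 d.+1 0 d.+3 + upd s4 d.+1 0 d.+1 = V j.+1 by updlia.
    by rewrite upd_upd; apply; lia.
  rewrite /s5; set t' := upd (upd _ _ _) _ _.
  have -> : j.+1 = (t' d.+2).+1; last exact: runs_inc.
  by rewrite /t'; updlia.
have [||||s4 H4 [h1 h2 h3]] := L (s1 d) 0 (upd s2 d.+2 0).
- by updlia; apply: p2; lia.
- by updlia.
- by updlia.
- by move=> i id; updlia; rewrite p2 ?p1 //; lia.
rewrite addn0 e1 in h2.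
exists (upd (upd s4 d (s4 d.+1)) d.+1 0).
  apply: runs_seq H1 _; apply: runs_seq H2 _; apply: runs_seq (runs_clear _ _) _.
  apply: runs_seq H4 _; have := @runs_move d.+1 d s4 (_ : d.+1 != d).
  by rewrite h1 addn0; apply; lia.
by split=> [|j jd]; updlia; apply: h3.
Qed.

End Runs.

(** * Primitive recursive functions of codes *)

Definition npr (f : (nat -> nat) -> nat) : Prop :=
  exists t, forall e, teval t e = f e.

Lemma npr_var i : npr (fun e => e i). Proof. by exists (TVar i). Qed.

Lemma npr_const n : npr (fun=> n).
Proof. by elim: n => [|n [t H]]; [exists TZero|exists (TSucc t) => e /=; rewrite H]. Qed.

Lemma npr_succ f : npr f -> npr (fun e => (f e).+1).
Proof. by move=> [t H]; exists (TSucc t) => e /=; rewrite H. Qed.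

Lemma npr_let f g : npr f -> npr g -> npr (fun e => g (scons (f e) e)).
Proof. by move=> [t H] [u H']; exists (TLet t u) => e /=; rewrite H H'. Qed.

Lemma npr_rec n b s : npr n -> npr b ->
  npr (fun e => s (e 0) (e 1) (fun i => e i.+2)) ->
  npr (fun e => nat_rec (fun=> nat) (b e) (fun i a => s i a e) (n e)).
Proof.
move=> [tn Hn] [tb Hb] [ts Hs]; exists (TRec tn tb ts) => e /=.
by rewrite Hn Hb; elim: (n e) => //= m ->; rewrite Hs.
Qed.

Definition npr1 (f : nat -> nat) := npr (fun e => f (e 0)).
Definition npr2 (f : nat -> nat -> nat) := npr (fun e => f (e 0) (e 1)).

Lemma npr_app1 f g : npr1 f -> npr g -> npr (fun e => f (g e)).
Proof. by move=> Hf Hg; exact: (npr_let Hg Hf). Qed.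

(** Renaming is needed for weakening: inside [npr_let] and [npr_rec] a function of the outer
    variables has to be read in a longer environment. *)
Fixpoint ren (rho : nat -> nat) (t : term) : term :=
  let up rho i := if i is j.+1 then (rho j).+1 else 0 in
  match t with
  | TVar i => TVar (rho i)
  | TZero => TZero
  | TSucc t => TSucc (ren rho t)
  | TLet t u => TLet (ren rho t) (ren (up rho) u)
  | TRec n b s => TRec (ren rho n) (ren rho b) (ren (up (up rho)) s)
  end.

Lemma npr_ren rho f : npr f -> npr (fun e => f (e \o rho)).
Proof.
move=> [t H]; exists (ren rho t) => e; rewrite -H {f H}.
elim: t rho e => //= [t IH|t IHt u IHu|n IHn b IHb s IHs] rho e.
- by rewrite IH.
- by rewrite IHt IHu; congr teval; apply/funext => -[].
- rewrite IHn IHb; congr nat_rec; apply/funext => i; apply/funext => a.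
  by rewrite IHs; congr teval; apply/funext => -[|[]].
Qed.

Lemma npr_app2 f g h : npr2 f -> npr g -> npr h -> npr (fun e => f (g e) (h e)).
Proof. by move=> Hf Hg Hh; apply: npr_let Hh (npr_let (npr_ren succn Hg) Hf). Qed.

Lemma npr_iter f n b : npr1 f -> npr n -> npr b -> npr (fun e => iter (n e) f (b e)).
Proof.
move=> Hf Hn Hb.
have [t H] := npr_rec (s := fun _ a _ => f a) Hn Hb (npr_app1 Hf (npr_var 1)).
by exists t => e; rewrite H; elim: (n e) => //= m ->.
Qed.

Lemma npr_eq f g : npr f -> f =1 g -> npr g.
Proof. by move=> [t H] fg; exists t => e; rewrite H. Qed.

Lemma npr_if0 c f g : npr c -> npr f -> npr g ->
  npr (fun e => if c e == 0 then f e else g e).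
Proof.
move=> Hc Hf Hg; have Hg' := npr_ren (addn 2) Hg.
by apply: npr_eq (npr_rec (s := fun _ _ => g) Hc Hf Hg') _ => e; case: (c e).
Qed.

Lemma npr2_add : npr2 addn.
Proof.
apply: npr_eq (npr_iter (npr_succ (npr_var 0)) (npr_var 0) (npr_var 1)) _.
by move=> e; elim: (e 0) => //= m ->.
Qed.

Lemma npr1_eq0 : npr1 (fun n => n == 0).
Proof.
apply: npr_eq (npr_iter (f := fun=> 0) (npr_const 0) (npr_var 0) (npr_const 1)) _.
by move=> e; case: (e 0).
Qed.

Lemma npr1_odd : npr1 odd.
Proof.
apply: npr_eq (npr_iter npr1_eq0 (npr_var 0) (npr_const 0)) _.
by move=> e; elim: (e 0) => //= m ->; case: (odd m).
Qed.

Lemma npr1_half : npr1 half.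
Proof.
have H := npr_app2 npr2_add (npr_app1 npr1_odd (npr_var 0)) (npr_var 1).
apply: npr_eq (npr_rec (s := fun i a _ => odd i + a) (npr_var 0) (npr_const 0) H) _.
by move=> e; elim: (e 0) => //= m ->; rewrite uphalf_half.
Qed.

Lemma npr1_double : npr1 double.
Proof.
apply: npr_eq (npr_app2 npr2_add (npr_var 0) (npr_var 0)) _.
by move=> e; rewrite addnn.
Qed.

(** This is the step of [CodeSeq.code], through which pairs, options and sequences are pickled; so
    [pickle_pair] and its companions hold by computation. *)
Definition ccons (a b : nat) : nat := 2 ^ a * b.*2.+1.
(** The exponent of 2 in [n]: the candidate [a] grows as long as [n] halved [a] times is even. By
    [ccons_gt], [n] rounds are enough. *)
Definition chd (n : nat) : nat := iter n (fun a => odd (iter a half n).+1 + a) 0.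
Definition ctl (n : nat) : nat := half (iter (chd n) half n).

Lemma iter_half a b k : iter k half (2 ^ (k + a) * b) = 2 ^ a * b.
Proof.
elim: k => // k IH; rewrite iterSr addSn expnS -mulnA mul2n doubleK; exact: IH.
Qed.

Lemma iter_halfK a b : iter a half (2 ^ a * b) = b.
Proof. by have := iter_half 0 b a; rewrite addn0 mul1n. Qed.

Lemma ccons_gt a b : (a < ccons a b) && (b < ccons a b).
Proof.
have := ltn_expl a (ltnSn 1); rewrite /ccons -addnn; move: (2 ^ a) => m.
by nia.
Qed.

Lemma chd_cons a b : chd (ccons a b) = a.
Proof.
rewrite /chd; set n := ccons a b.
have H k : iter k (fun a => odd (iter a half n).+1 + a) 0 = minn k a.
  elim: k => [|k IH]; first by rewrite min0n.
  rewrite iterS IH; case: (ltnP k a) => ka.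
    rewrite (minn_idPl ka) /n /ccons.
    rewrite -{1}(subnKC (ltnW ka)) iter_half -(subnSK ka) expnS -mulnA mul2n /=.
    by rewrite odd_double.
  rewrite (minn_idPr (leqW ka)) /n /ccons.
  by rewrite iter_halfK /= odd_double.
by rewrite H; apply/minn_idPr; case/andP: (ccons_gt a b) => /ltnW.
Qed.

Lemma ctl_cons a b : ctl (ccons a b) = b.
Proof.
by rewrite /ctl chd_cons /ccons iter_halfK -addn1 halfD /= odd_double doubleK addn0.
Qed.

Lemma npr1_hd : npr1 chd.
Proof.
have H : npr (fun e => odd (iter (e 1) half (e 2)).+1 + e 1).
  apply: npr_app2 npr2_add _ (npr_var 1); apply: npr_app1 npr1_odd _.
  by apply: npr_succ; apply: npr_iter npr1_half _ _; exact: npr_var.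
apply: npr_eq (npr_rec (s := fun i a e => odd (iter a half (e 0)).+1 + a)
  (npr_var 0) (npr_const 0) H) _ => e.
pose f a := odd (iter a half (e 0)).+1 + a.
change (nat_rec (fun=> nat) 0 (fun=> f) (e 0) = iter (e 0) f 0).
by elim: (e 0) => //= m ->.
Qed.

Lemma npr1_tl : npr1 ctl.
Proof.
apply: npr_app1 npr1_half _; apply: npr_iter npr1_half _ (npr_var 0).
exact: npr1_hd.
Qed.

Lemma npr2_cons : npr2 ccons.
Proof.
apply: npr_eq (npr_iter npr1_double (npr_var 0) (npr_succ (npr_app1 npr1_double (npr_var 1)))) _.
move=> e; rewrite /ccons; elim: (e 0) => [|m IH] /=; first by rewrite mul1n.
by rewrite IH expnS -mulnA mul2n.
Qed.

(** * Primitive recursive functions between countable types *)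

(** Nothing is asked of [g] at numbers that are not codes, so no decoding enters the closure
    properties below. *)
Definition pr (A B : countType) (f : A -> B) : Prop :=
  exists2 g, npr1 g & forall a, g (pickle a) = pickle (f a).

Section Codes.
Variables A B : countType.

Lemma pickle_pair (x : A) (y : B) :
  pickle (x, y) = ccons (pickle x) (ccons (pickle y) 0).
Proof. by []. Qed.
Lemma pickle_some (x : A) : pickle (Some x) = ccons (pickle x) 0. Proof. by []. Qed.
Lemma pickle_cons (x : A) s : pickle (x :: s) = ccons (pickle x) (pickle s).
Proof. by []. Qed.
Lemma pickle_nat (n : nat) : pickle n = n. Proof. by []. Qed.
Lemma pickle_bool (b : bool) : pickle b = b. Proof. by []. Qed.
Lemma ccons_neq0 a b : (ccons a b == 0) = false.
Proof. by case/andP: (ccons_gt a b); case: ccons. Qed.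
End Codes.

Section Closure.
Implicit Types A B C D : countType.

Lemma pr_ext A B (f g : A -> B) : pr f -> f =1 g -> pr g.
Proof. by move=> [h H e] fg; exists h => // a; rewrite e fg. Qed.

Lemma pr_id A : pr (fun a : A => a).
Proof. by exists (fun n => n) => //; apply: npr_var. Qed.

Lemma pr_const A B (b : B) : pr (fun _ : A => b).
Proof. by exists (fun=> pickle b) => //; apply: npr_const. Qed.

Lemma pr_app A B C (g : B -> C) (f : A -> B) : pr g -> pr f -> pr (fun a => g (f a)).
Proof.
move=> [g' Hg eg] [f' Hf ef]; exists (g' \o f'); first exact: npr_app1 Hg Hf.
by move=> a /=; rewrite ef eg.
Qed.

Lemma pr_pair A B C (f : A -> B) (g : A -> C) : pr f -> pr g -> pr (fun a => (f a, g a)).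
Proof.
move=> [f' Hf ef] [g' Hg eg]; exists (fun n => ccons (f' n) (ccons (g' n) 0)).
  by apply: npr_app2 npr2_cons Hf (npr_app2 npr2_cons Hg (npr_const 0)).
by move=> a; rewrite ef eg.
Qed.

Lemma pr_fst A B C (f : A -> B * C) : pr f -> pr (fun a => (f a).1).
Proof.
move=> [f' Hf ef]; exists (chd \o f'); first exact: npr_app1 npr1_hd Hf.
by move=> a /=; rewrite ef; case: (f a) => x y; rewrite pickle_pair chd_cons.
Qed.

Lemma pr_snd A B C (f : A -> B * C) : pr f -> pr (fun a => (f a).2).
Proof.
move=> [f' Hf ef]; exists (chd \o ctl \o f').
  by apply: npr_app1 npr1_hd (npr_app1 npr1_tl Hf).
by move=> a /=; rewrite ef; case: (f a) => x y; rewrite pickle_pair ctl_cons chd_cons.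
Qed.

Lemma pr_app2 A B C D (h : B -> C -> D) (f : A -> B) (g : A -> C) :
  pr (fun p : B * C => h p.1 p.2) -> pr f -> pr g -> pr (fun a => h (f a) (g a)).
Proof. by move=> Hh Hf Hg; apply: (pr_app Hh (pr_pair Hf Hg)). Qed.

Lemma pr_rec A C (n : A -> nat) (b : A -> C) (s : A -> nat -> C -> C) :
  pr (fun q : A * nat * C => s q.1.1 q.1.2 q.2) -> pr n -> pr b ->
  pr (fun a => nat_rect (fun=> C : Type) (b a) (s a) (n a)).
Proof.
move=> [s' Hs es] [n' Hn en] [b' Hb eb].
exists (fun x => nat_rec (fun=> nat) (b' x) (fun i c => s' (ccons
  (ccons x (ccons i 0)) (ccons c 0))) (n' x)).
  apply: (npr_rec (s := fun i c e => s' (ccons (ccons (e 0) (ccons i 0))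
    (ccons c 0))) Hn Hb); apply: npr_app1 Hs _.
  by do ?apply: (npr_app2 npr2_cons); try exact: npr_var; exact: npr_const.
move=> a; rewrite en eb pickle_nat; elim: (n a) => //= m ->.
by rewrite -[ccons m 0]/(ccons (pickle m) 0) -!pickle_pair es.
Qed.

Lemma pr_iter A C (n : A -> nat) (b : A -> C) (s : A -> C -> C) :
  pr (fun q : A * C => s q.1 q.2) -> pr n -> pr b ->
  pr (fun a => iter (n a) (s a) (b a)).
Proof.
move=> Hs Hn Hb; have Hs' : pr (fun q : A * nat * C => s q.1.1 q.2).
  by apply: (pr_app2 Hs); [do 2?apply: pr_fst|apply: pr_snd]; exact: pr_id.
by apply: pr_ext (pr_rec (s := fun a _ => s a) Hs' Hn Hb) _ => a; elim: (n a) => //= m ->.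
Qed.

Lemma pr_succ A (f : A -> nat) : pr f -> pr (fun a => (f a).+1).
Proof. by move=> [f' Hf ef]; exists (succn \o f') => [|a /=]; [exact: npr_succ|rewrite ef]. Qed.

Lemma pr_addn A (f g : A -> nat) : pr f -> pr g -> pr (fun a => f a + g a).
Proof.
move=> [f' Hf ef] [g' Hg eg]; exists (fun n => f' n + g' n) => [|a /=].
  exact: npr_app2 npr2_add Hf Hg.
by rewrite ef eg.
Qed.

Lemma pr_muln A (f g : A -> nat) : pr f -> pr g -> pr (fun a => f a * g a).
Proof.
have H : pr (fun p : nat * nat => p.1 * p.2).
  have Hs : pr (fun q : nat * nat * nat => q.1.2 + q.2).
    by apply: pr_addn; [apply: pr_snd; apply: pr_fst|apply: pr_snd]; exact: pr_id.
  have Hi := pr_iter (s := fun q c => q.2 + c) Hs (pr_fst (pr_id _)) (pr_const _ 0).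
  by apply: pr_ext Hi _ => -[m n] /=; rewrite iter_addn_0 mulnC.
exact: pr_app2 H.
Qed.

Lemma pr_pred A (f : A -> nat) : pr f -> pr (fun a => (f a).-1).
Proof.
apply: (@pr_app _ _ _ predn).
have Hs : pr (fun q : nat * nat * nat => q.1.2) by apply/pr_snd/pr_fst/pr_id.
by apply: pr_ext (pr_rec (s := fun _ i _ => i) Hs (pr_id _) (pr_const _ 0)) _ => -[].
Qed.

Lemma pr_subn A (f g : A -> nat) : pr f -> pr g -> pr (fun a => f a - g a).
Proof.
have H : pr (fun p : nat * nat => p.1 - p.2).
  have Hs : pr (fun q : nat * nat * nat => q.2.-1) by apply/pr_pred/pr_snd/pr_id.
  have Hi := pr_iter (s := fun _ => predn) Hs (pr_snd (pr_id _)) (pr_fst (pr_id _)).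
  by apply: pr_ext Hi _ => -[m n] /=; elim: n => [|n IH]; rewrite ?subn0 // iterS IH subnS.
exact: pr_app2 H.
Qed.

Lemma pr_if A B (c : A -> bool) (f g : A -> B) :
  pr c -> pr f -> pr g -> pr (fun a => if c a then f a else g a).
Proof.
move=> [c' Hc ec] [f' Hf ef] [g' Hg eg].
exists (fun n => if c' n == 0 then g' n else f' n); first exact: npr_if0.
by move=> a; rewrite ec eg ef pickle_bool eqb0; case: (c a).
Qed.

Lemma pr_neg A (f : A -> bool) : pr f -> pr (fun a => ~~ f a).
Proof. by move=> Hf; apply: (pr_if Hf); exact: pr_const. Qed.

Lemma pr_and A (f g : A -> bool) : pr f -> pr g -> pr (fun a => f a && g a).
Proof. by move=> Hf Hg; apply: (pr_if Hf Hg); exact: pr_const. Qed.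

Lemma pr_eqn0 A (f : A -> nat) : pr f -> pr (fun a => f a == 0).
Proof.
move=> [f' Hf ef]; exists (fun n => f' n == 0); first exact: npr_app1 npr1_eq0 Hf.
by move=> a; rewrite ef.
Qed.

Lemma pr_pickle A B (f : A -> B) : pr f -> pr (fun a => pickle (f a)).
Proof. by move=> [f' Hf ef]; exists f'. Qed.

Lemma pr_leq A (f g : A -> nat) : pr f -> pr g -> pr (fun a => f a <= g a).
Proof. by move=> Hf Hg; apply: pr_eqn0; apply: pr_subn. Qed.

Lemma pr_eq A B (f g : A -> B) : pr f -> pr g -> pr (fun a => f a == g a).
Proof.
move=> /pr_pickle Hf /pr_pickle Hg.
apply: pr_ext (pr_and (pr_leq Hf Hg) (pr_leq Hg Hf)) _ => a.
by rewrite -eqn_leq (inj_eq (pcan_inj pickleK)).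
Qed.

Lemma pr_odd A (f : A -> nat) : pr f -> pr (fun a => odd (f a)).
Proof.
move=> [f' Hf ef]; exists (fun n => odd (f' n)); first exact: npr_app1 npr1_odd Hf.
by move=> a; rewrite ef.
Qed.

Lemma pr_half A (f : A -> nat) : pr f -> pr (fun a => (f a)./2).
Proof.
move=> [f' Hf ef]; exists (fun n => half (f' n)); first exact: npr_app1 npr1_half Hf.
by move=> a; rewrite ef.
Qed.

Lemma pr_some A B (f : A -> B) : pr f -> pr (fun a => Some (f a)).
Proof.
move=> [f' Hf ef]; exists (fun n => ccons (f' n) 0) => [|a]; last by rewrite ef.
exact: npr_app2 npr2_cons Hf (npr_const 0).
Qed.

Lemma pr_match_option A B C (o : A -> option B) (f : A -> B -> C) (g : A -> C) :
  pr (fun p : A * B => f p.1 p.2) -> pr o -> pr g ->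
  pr (fun a => if o a is Some x then f a x else g a).
Proof.
move=> [f' Hf ef] [h Ho eh] [g' Hg eg].
exists (fun n => if h n == 0 then g' n
  else f' (ccons n (ccons (chd (h n)) 0))).
  apply: npr_if0 => //; apply: npr_app1 Hf _.
  apply: npr_app2 npr2_cons (npr_var 0) _; apply: npr_app2 npr2_cons _ (npr_const 0).
  exact: npr_app1 npr1_hd Ho.
move=> a; rewrite eh; case: (o a) => [x|]; last by rewrite eg.
by rewrite pickle_some ccons_neq0 chd_cons -pickle_pair ef.
Qed.

Lemma pr_nil A B : pr (fun _ : A => [::] : seq B).
Proof. exact: pr_const. Qed.

Lemma pr_cons A B (f : A -> B) (g : A -> seq B) :
  pr f -> pr g -> pr (fun a => f a :: g a).
Proof.
move=> [f' Hf ef] [g' Hg eg]; exists (fun n => ccons (f' n) (g' n)).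
  exact: npr_app2 npr2_cons Hf Hg.
by move=> a; rewrite ef eg.
Qed.

Lemma pr_ohead A B (l : A -> seq B) : pr l -> pr (fun a => ohead (l a)).
Proof.
move=> [l' Hl el]; exists (fun n => if l' n == 0 then 0 else ccons (chd (l' n)) 0).
  apply: npr_if0 => //; first exact: npr_const.
  by apply: npr_app2 npr2_cons _ (npr_const 0); apply: npr_app1 npr1_hd Hl.
move=> a; rewrite el; case: (l a) => // x s.
by rewrite pickle_cons ccons_neq0 chd_cons.
Qed.

Lemma pr_behead A B (l : A -> seq B) : pr l -> pr (fun a => behead (l a)).
Proof.
move=> [l' Hl el]; exists (ctl \o l'); first exact: npr_app1 npr1_tl Hl.
by move=> a /=; rewrite el; case: (l a) => // x s; rewrite pickle_cons ctl_cons.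
Qed.

(** Lets the code of a list, which is at hand, bound the number of rounds of a loop over the
    list. *)
Lemma size_pickle B (s : seq B) : size s <= pickle s.
Proof.
elim: s => //= x s IH; rewrite pickle_cons (leq_ltn_trans IH) //.
by case/andP: (ccons_gt (pickle x) (pickle s)).
Qed.

Lemma pr_foldl A B C (f : A -> C -> B -> C) (b : A -> C) (l : A -> seq B) :
  pr (fun q : A * C * B => f q.1.1 q.1.2 q.2) -> pr b -> pr l ->
  pr (fun a => foldl (f a) (b a) (l a)).
Proof.
move=> Hf Hb Hl.
(* iterate on (accumulator, remaining list); further steps do nothing *)
pose s a (q : C * seq B) := if ohead q.2 is Some x then (f a q.1 x, behead q.2) else q.
have Hs : pr (fun q : A * (C * seq B) => s q.1 q.2).
  apply: pr_match_option; [|by apply/pr_ohead/pr_snd/pr_snd/pr_id|by apply/pr_snd/pr_id].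
  apply: pr_pair; last by apply/pr_behead/pr_snd/pr_snd/pr_fst/pr_id.
  apply: (pr_app (f := fun q : A * (C * seq B) * B => (q.1.1, q.1.2.1, q.2)) Hf).
  apply: pr_pair; last exact/pr_snd/pr_id.
  by apply: pr_pair; [apply/pr_fst/pr_fst/pr_id|apply/pr_fst/pr_snd/pr_fst/pr_id].
apply: pr_ext (pr_fst (pr_iter Hs (pr_pickle Hl) (pr_pair Hb Hl))) _ => a.
have : size (l a) <= pickle (l a) := size_pickle _.
move: (pickle (l a)) => k; elim: k (b a) (l a) => [|n IH] c [|x t] // Hn.
  by rewrite iterSr; exact: (IH c [::]).
by rewrite iterSr; exact: (IH (f a c x) t).
Qed.

Lemma pr_rev A B (l : A -> seq B) : pr l -> pr (fun a => rev (l a)).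
Proof.
move=> Hl; have H : pr (fun q : A * seq B * B => q.2 :: q.1.2).
  by apply: pr_cons; [apply/pr_snd/pr_id|apply/pr_snd/pr_fst/pr_id].
apply: pr_ext (pr_foldl (f := fun _ s x => x :: s) H (pr_nil _ _) Hl) _ => a.
by rewrite -[RHS]cats0 -catrevE; elim: (l a) [::] => //= x s IH t; rewrite IH.
Qed.

Lemma pr_foldr A B C (f : A -> B -> C -> C) (b : A -> C) (l : A -> seq B) :
  pr (fun q : A * B * C => f q.1.1 q.1.2 q.2) -> pr b -> pr l ->
  pr (fun a => foldr (f a) (b a) (l a)).
Proof.
move=> Hf Hb Hl; have Hf' : pr (fun q : A * C * B => f q.1.1 q.2 q.1.2).
  apply: (pr_app (f := fun q : A * C * B => (q.1.1, q.2, q.1.2)) Hf).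
  apply: pr_pair; last exact/pr_snd/pr_fst/pr_id.
  by apply: pr_pair; [apply/pr_fst/pr_fst/pr_id|apply/pr_snd/pr_id].
apply: pr_ext (pr_foldl (f := fun a c x => f a x c) Hf' Hb (pr_rev Hl)) _ => a.
by rewrite foldl_rev.
Qed.

Lemma pr_cat A B (l m : A -> seq B) : pr l -> pr m -> pr (fun a => l a ++ m a).
Proof.
move=> Hl Hm; have H : pr (fun q : A * B * seq B => q.1.2 :: q.2).
  by apply: pr_cons; [apply/pr_snd/pr_fst/pr_id|apply/pr_snd/pr_id].
apply: pr_ext (pr_foldr (f := fun _ x s => x :: s) H Hm Hl) _ => a.
by elim: (l a) => //= x s ->.
Qed.

Lemma pr_rcons A B (l : A -> seq B) (f : A -> B) :
  pr l -> pr f -> pr (fun a => rcons (l a) (f a)).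
Proof.
move=> Hl Hf; apply: pr_ext (pr_cat Hl (pr_cons Hf (pr_nil _ _))) _ => a.
by rewrite cats1.
Qed.

Lemma pr_size A B (l : A -> seq B) : pr l -> pr (fun a => size (l a)).
Proof.
move=> Hl; have H : pr (fun q : A * B * nat => q.2.+1) by apply/pr_succ/pr_snd/pr_id.
apply: pr_ext (pr_foldr (f := fun _ _ n => n.+1) H (pr_const _ 0) Hl) _ => a.
by elim: (l a) => //= x s ->.
Qed.

Lemma pr_map A B C (f : A -> B -> C) (l : A -> seq B) :
  pr (fun q : A * B => f q.1 q.2) -> pr l -> pr (fun a => map (f a) (l a)).
Proof.
move=> Hf Hl; have H : pr (fun q : A * B * seq C => f q.1.1 q.1.2 :: q.2).
  by apply: pr_cons; [exact: pr_app Hf (pr_fst (pr_id _))|apply/pr_snd/pr_id].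
apply: pr_ext (pr_foldr (f := fun a x s => f a x :: s) H (pr_nil _ _) Hl) _ => a.
by elim: (l a) => //= x s ->.
Qed.

Lemma pr_flatten A B (l : A -> seq (seq B)) : pr l -> pr (fun a => flatten (l a)).
Proof.
move=> Hl; apply: (pr_foldr (f := fun _ s t => s ++ t) _ (pr_nil _ _) Hl).
by apply: pr_cat; [apply/pr_snd/pr_fst/pr_id|apply/pr_snd/pr_id].
Qed.

Lemma pr_mkseq A B (f : A -> nat -> B) (n : A -> nat) :
  pr (fun q : A * nat => f q.1 q.2) -> pr n -> pr (fun a => mkseq (f a) (n a)).
Proof.
move=> Hf Hn; have H : pr (fun q : A * nat * seq B => rcons q.2 (f q.1.1 q.1.2)).
  by apply: pr_rcons; [apply/pr_snd/pr_id|exact: pr_app Hf (pr_fst (pr_id _))].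
apply: pr_ext (pr_rec (s := fun a i s => rcons s (f a i)) H Hn (pr_nil _ _)) _ => a.
by elim: (n a) => //= m ->; rewrite mkseqS.
Qed.

Lemma pr_nseq A B (x : A -> B) (n : A -> nat) :
  pr x -> pr n -> pr (fun a => nseq (n a) (x a)).
Proof.
move=> Hx Hn; have H : pr (fun q : A * nat => x q.1) by exact: pr_app Hx (pr_fst (pr_id _)).
apply: pr_ext (pr_mkseq (f := fun a _ => x a) H Hn) _ => a.
apply: (@eq_from_nth _ (x a)); rewrite size_mkseq ?size_nseq // => i ilt.
by rewrite nth_mkseq // nth_nseq ilt.
Qed.

Lemma pr_drop A B (n : A -> nat) (l : A -> seq B) :
  pr n -> pr l -> pr (fun a => drop (n a) (l a)).
Proof.
move=> Hn Hl; have H : pr (fun q : A * seq B => behead q.2) by apply/pr_behead/pr_snd/pr_id.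
apply: pr_ext (pr_iter (s := fun _ => behead) H Hn Hl) _ => a.
by elim: (n a) => [|m IH]; rewrite ?drop0 // iterS IH -drop1 drop_drop.
Qed.

Lemma pr_nth A B (x : A -> B) (l : A -> seq B) (n : A -> nat) :
  pr x -> pr l -> pr n -> pr (fun a => nth (x a) (l a) (n a)).
Proof.
move=> Hx Hl Hn; have H := pr_ohead (pr_drop Hn Hl).
have H' : pr (fun q : A * B => q.2) by apply/pr_snd/pr_id.
apply: pr_ext (pr_match_option (f := fun _ y => y) H' H Hx) _ => a.
by rewrite -[n a in RHS]addn0 -nth_drop; case: drop.
Qed.

End Closure.

(** * Words and tapes *)

Definition word (q : baire) (n : nat) : seq bool :=
  flatten [seq rcons (nseq (q i) true) false | i <- iota 0 n].

Lemma wordS q n : word q n.+1 = word q n ++ rcons (nseq (q n) true) false.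
Proof. by rewrite /word -addn1 iotaD map_cat flatten_cat /= cats0 add0n. Qed.

Lemma size_wordS q n : size (word q n.+1) = size (word q n) + (q n).+1.
Proof. by rewrite wordS size_cat size_rcons size_nseq. Qed.

Lemma size_word q n : n <= size (word q n).
Proof. by elim: n => // n IH; rewrite size_wordS addnS ltnS (leq_trans IH) ?leq_addr. Qed.

Lemma size_word_leq q m n : m <= n -> size (word q m) <= size (word q n).
Proof.
move=> /subnKC <-; elim: (n - m) => [|k IH]; first by rewrite addn0.
by apply: leq_trans IH _; rewrite addnS size_wordS leq_addr.
Qed.

Lemma word_prefix q m n i : m <= n -> i < size (word q m) ->
  nth false (word q n) i = nth false (word q m) i.
Proof.
move=> /subnKC <-; elim: (n - m) => [|k IH] im; first by rewrite addn0.
by rewrite addnS wordS nth_cat -IH // ifT // (leq_trans im) // size_word_leq ?leq_addr.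
Qed.

Lemma nth_word q m i : i < size (word q m) -> nth false (word q m) i = tape q i.
Proof.
move=> im; rewrite -[tape q i]/(nth false (word q i.+1) i).
have := size_word q i.+1 => ii.
by case: (leqP m i.+1) => h; [rewrite (word_prefix h)|rewrite (word_prefix (ltnW h))].
Qed.

(** The last value read comes first; the second component counts the bits 1 of
    the incomplete block. *)
Definition parse_bit (s : seq nat * nat) (b : bool) : seq nat * nat :=
  if b then (s.1, s.2.+1) else (s.2 :: s.1, 0).
Definition parse_bits (w : seq bool) : seq nat * nat := foldl parse_bit ([::], 0) w.

Lemma parse_cat v w : parse_bits (v ++ w) = foldl parse_bit (parse_bits v) w.
Proof. by rewrite /parse_bits foldl_cat. Qed.

Lemma parse_word q n : parse_bits (word q n) = (rev (mkseq q n), 0).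
Proof.
elim: n => // n IH; rewrite wordS parse_cat IH.
have H s k m : foldl parse_bit (s, k) (rcons (nseq m true) false) = (k + m :: s, 0).
  by elim: m k => [|m IHm] k /=; rewrite ?addn0 // IHm addSnnS.
by rewrite H mkseqS rev_rcons.
Qed.

Lemma parse_tape q s : exists2 n, (parse_bits (mkseq (tape q) s)).1 = rev (mkseq q n) &
  forall m, size (word q m) <= s -> m <= n.
Proof.
(* What the induction on [s] needs: the first [s] cells consist of [n] complete blocks and [c] bits
   1 of the next block. *)
suff [n [c [e cq es]]] : exists n c, [/\ parse_bits (mkseq (tape q) s) = (rev (mkseq q n), c),
    c <= q n & s = size (word q n) + c].
  exists n => [|m]; first by rewrite e.
  case: (leqP m n) => // nm; rewrite leqNgt => /negP[]; rewrite es.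
  apply: (@leq_trans (size (word q n.+1))); first by rewrite size_wordS ltn_add2l.
  exact: size_word_leq.
elim: s => [|s [n [c [e cq es]]]]; first by exists 0, 0.
rewrite mkseqS -cats1 parse_cat e /=.
have -> : tape q s = (c < q n).
  rewrite -(@nth_word q n.+1) ?es ?size_wordS ?ltn_add2l // wordS nth_cat.
  rewrite ltnNge leq_addr /= addKn nth_rcons size_nseq nth_nseq.
  by case: ltnP; rewrite ?if_same.
case: ltnP => cq'.
  by exists n, c.+1; split=> //; rewrite es; lia.
exists n.+1, 0; split=> //.
  by rewrite /parse_bit /= mkseqS rev_rcons; congr (_ :: _, _); apply/eqP; rewrite eqn_leq cq cq'.
by rewrite es size_wordS; lia.
Qed.

(** * One-way machines *)

Lemma lookup_mem M k a : lookup M k = Some a -> (k, a) \in M.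
Proof.
rewrite /lookup; elim: M => //= -[k' a'] M IH /=; rewrite inE.
by case: eqP => /= [-> [->]|_ /IH ->]; rewrite ?eqxx ?orbT.
Qed.

Section OneWay.
Variables (M : machine) (inp : nat -> bool).
Hypothesis M1 : one_way M.

(** A staying head rewrites the scanned symbol, and a moving one writes on a cell that was blank; so
    no symbol is ever lost, and the cells from the head on remain blank. *)
Lemma one_way_stp c : (forall n, out_pos c <= n -> out c n = None) ->
  (forall n, out_pos (stp M inp c) <= n -> out (stp M inp c) n = None) /\
  (forall n b, out c n = Some b -> out (stp M inp c) n = Some b).
Proof.
move=> H; rewrite /stp /step.
case e: (lookup _ _) => [[[[q w] o] [[mi mw] mo]]|] //=.
have := M1 (lookup_mem e) => /= -[[-> ->]|[-> oN]] /=.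
  by split=> [n|n b] /=; case: eqP => [->|_]; [move=> _; apply: H|apply: H|move=> ->|].
split=> [n|n b] /=.
  by case: eqP => [->|_ /ltnW /H //]; rewrite ltnn.
by case: eqP => [->|_ //]; rewrite H.
Qed.

Lemma one_way_stable t t' n b : t <= t' -> out (run M inp t) n = Some b ->
  out (run M inp t') n = Some b.
Proof.
have G s : forall n, out_pos (run M inp s) <= n -> out (run M inp s) n = None.
  by elim: s => // s IH; have [] := one_way_stp IH.
move=> /subnKC <-; elim: (t' - t) => [|k IH] e; first by rewrite addn0.
by rewrite addnS; have [_ H] := one_way_stp (G (t + k)); apply/H/IH.
Qed.

End OneWay.

Lemma tm_one_way prog c : right_only prog -> one_way (tm (IJmp 0 :: compile 1 prog) c).
Proof.
move=> rp; set code := _ :: _.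
have noleft pc : pc < size code -> nth ILeft code pc <> ILeft.
  have H : forall b, (forall pc, pc < size (compile b prog) -> nth ILeft (compile b prog) pc <> ILeft).
    elim: prog rp {code} => //= [r|r|r|x|p IHp q IHq|r p IHp] rp b i; try by case: i.
    - by case: i => [|[]].
    - rewrite nth_cat size_cat; case/andP: rp => rp rq lt'.
      case: (ltnP i (size (compile b p))) => [lt|ge].
        exact: (IHp rp _ _ lt).
      by apply: (IHq rq); rewrite ltn_subLR.
    - case: i => //= i; rewrite ltnS size_cat nth_cat /= => le.
      case: (ltnP i (size (compile b.+1 p))) => [lt|ge].
        exact: (IHp rp _ _ lt).
      by rewrite (_ : i - _ = 0) //; lia.
  case: pc => // pc; exact: H.
have tab k a : (k, a) \in table code -> k \in keys code /\ a = delta code k.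
  by move=> /mapP[k' kin [-> ->]].
have cls k a : (k, a) \in tm code c ->
    (k.2 = None /\ exists q w m, a = (q, w, None, (Stay, m, Stay))) \/
    (k \in keys code /\ a = delta code k).
  rewrite mem_cat => /orP[/mapP[b _ [-> ->]]|]; first by left; split=> //; do 3 eexists.
  elim: c => [|c IH]; rewrite (ramp0, rampS) mem_cat => /orP[/mapP[b _ [-> ->]]|].
  - by left; split=> //; do 3 eexists.
  - by move=> /tab; right.
  - by left; split=> //; do 3 eexists.
  - exact: IH.
move=> [[[q b] w] o] a /cls[[/= -> [q' [w' [m ->]]]]|[kin ->]]; first by left.
rewrite /delta; case: ifP => _; first by case: ifP; left.
case: ifP => _; first by left.
(* [ILeft] is also the default of [nth], so the address has to be shown to lie inside the code. *)
have /noleft : q.-1 %/ 3 < size code.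
  have /= /andP[q0 qs] := keys_state kin.
  by rewrite ltn_divLR // mulnC prednK.
by case: (nth _ _ _) => //= [r _|r _|r l _|l _|l _|x _]; try (case: ifP => _); try (by left); right.
Qed.

(** * Machines from primitive recursive functions *)

(** [runs_term] asks that all variables live below [d]; those from [d] on are sent to register 0. *)
Definition regvar (d i : nat) : nat := if i < d then i else 0.

Lemma assignP f d r : npr f -> r < d ->
  exists2 p, right_only p & forall P inp s, exists2 s', runs P inp p s s' &
    s' r = f (s \o regvar d) /\ forall j, j < d -> j != r -> s' j = s j.
Proof.
move=> [t Ht] rd; exists (prog_of (regvar d) d t ;; clear r ;; move_reg d r).
  by rewrite /= right_only_prog_of.
move=> P inp s; have [|s1 H1 [e1 p1]] := runs_term P inp t (rho := regvar d) (d := d) s.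
  by move=> i; rewrite /regvar; case: ifP => //; lia.
exists (upd (upd (upd s1 r 0) r (s1 d)) d 0).
  apply: runs_seq H1 _; apply: runs_seq (runs_clear _ _ _ _) _.
  have := @runs_move P inp d r (upd s1 r 0) (_ : d != r).
  have -> : upd s1 r 0 d + upd s1 r 0 r = s1 d by updlia.
  by apply; lia.
split; first by rewrite -Ht -e1; updlia.
by move=> j jd jr; updlia; apply: p1.
Qed.

(** Register 1 holds the values read so far and register 2 the number of bits 1
    of the current block, as in [parse_bit]; 4 and 5 are scratch. *)
Lemma read_bitP : exists2 p, right_only p & forall P inp s i o a st,
  s 1 = pickle st.1 -> s 2 = st.2 ->
  exists2 s', exec P inp p (Memory s i o a) (Memory s' i.+1 o a) &
    [/\ s' 1 = pickle (parse_bit st (inp i)).1, s' 2 = (parse_bit st (inp i)).2,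
      s' 0 = s 0 & s' 3 = s 3].
Proof.
have H1 : npr (fun e => if e 4 == 0 then ccons (e 2) (e 1) else e 1).
  apply: npr_if0; try exact: npr_var.
  by apply: npr_app2 npr2_cons _ _; exact: npr_var.
have H2 : npr (fun e => if e 4 == 0 then 0 else (e 2).+1).
  by apply: npr_if0 => //; [exact: npr_var|exact: npr_const|apply/npr_succ/npr_var].
have [p1 r1 {}H1] := @assignP _ 7 5 H1 isT.
have [p2 r2 {}H2] := @assignP _ 7 2 H2 isT.
have [p3 r3 H3] := @assignP _ 7 1 (npr_var 5) isT.
exists (clear 4 ;; PRead 4 ;; p1 ;; p2 ;; p3); first by rewrite /= r1 r2 r3.
move=> P inp s i o a st s1 s2.
have [t1 X1 [v1 k1]] := H1 P inp (upd (upd s 4 0) 4 (inp i + upd s 4 0 4)).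
have [t2 X2 [v2 k2]] := H2 P inp t1; have [t3 X3 [v3 k3]] := H3 P inp t2.
exists t3.
  apply: XSeq (runs_clear P inp 4 s i o a) _; apply: XSeq (XRead _ _ _ _ _ _ _) _.
  apply: XSeq (X1 _ _ _) _; apply: XSeq (X2 _ _ _) _; exact: X3.
split; last 2 first.
- by rewrite k3 // k2 // k1.
- by rewrite k3 // k2 // k1.
- rewrite v3 /= k2 // v1 /= !updE /= addn0 s1 s2.
  by rewrite /parse_bit; case: (inp i).
rewrite k3 // v2 /= !k1 // !updE /= addn0 s2.
by rewrite /parse_bit; case: (inp i).
Qed.

Lemma code_at_prog prog : code_at (IJmp 0 :: compile 1 prog) 1 (compile 1 prog).
Proof. by exists [:: IJmp 0], [::]; rewrite cats0. Qed.

Definition out_is (w : seq bool) (o : nat -> option bool) : Prop :=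
  forall n, o n = if n < size w then Some (nth false w n) else None.

Lemma out_is_rcons w o b : out_is w o -> out_is (rcons w b) (upd o (size w) (Some b)).
Proof.
move=> H n; rewrite updE size_rcons nth_rcons H ltnS.
by case: (ltngtP n (size w)) => // ->; rewrite eqxx.
Qed.

(** [None] means that the prefix read so far does not determine [q n]. Since every answer given is
    correct, the machine may write it at once and never needs to revise. Answers have to exist for
    all long prefixes, because position [n] comes up only after the earlier blocks are written, when
    more input has been read. *)
Lemma one_way_machine (psi : nat * seq nat -> option nat) : pr psi ->
  exists2 M, one_way M & forall x q,
    (forall n k v, psi (n, mkseq x k) = Some v -> v = q n) ->
    (forall n, exists k0, forall k, k0 <= k -> psi (n, mkseq x k) <> None) ->
    produces M x q.
Proof.
move=> Hpsi.
(* Register 1 holds the values read with the latest one first, hence [rev]. *)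
have [g Hg eg] : pr (fun p : nat * seq nat => psi (p.1, rev p.2)).
  by apply: (pr_app Hpsi); apply: pr_pair; [|apply: pr_rev]; [apply/pr_fst/pr_id|apply/pr_snd/pr_id].
have Hg4 : npr (fun e => g (ccons (e 3) (ccons (e 1) 0))).
  apply: npr_app1 Hg _; do ?apply: (npr_app2 npr2_cons); try exact: npr_var.
  exact: npr_const.
have [prd rrd Hrd] := read_bitP.
have [p4 r4 H4] := @assignP _ 7 4 Hg4 isT.
have [p5 r5 H5] := @assignP _ 7 5 (npr_app1 npr1_hd (npr_var 4)) isT.
(* Register 4 holds the code of the answer, which is 0 exactly for [None], so [PWhile 4] acts as a
   conditional, left by the final [clear 4]. Register 5 holds the value in the answer, and register
   3 the number of blocks written. *)
pose body := prd ;; p4 ;; p5 ;; PWhile 4 (PWhile 5 (PDec 5 ;; POut true) ;;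
  POut false ;; PInc 3 ;; clear 4).
pose prog := PWhile 0 body.
have ow : one_way (tm (IJmp 0 :: compile 1 prog) 0).
  by apply: tm_one_way; rewrite /= rrd r4 r5.
exists (tm (IJmp 0 :: compile 1 prog) 0) => // x q sound live.
pose inp := tape x; pose T := fun _ : nat -> option bool => True.
pose vals i := (parse_bits (mkseq inp i)).1.
pose cnt := fix cnt i := if i is j.+1 then
  (if psi (cnt j, rev (vals j.+1)) is Some _ then (cnt j).+1 else cnt j) else 0.
have vals_mkseq i : exists2 k, rev (vals i) = mkseq x k &
    forall m, size (word x m) <= i -> m <= k.
  by have [k e H] := parse_tape x i; exists k => //; rewrite /vals e revK.
pose Inv i m := [/\ regs m 0 = 1, regs m 1 = pickle (vals i),
  regs m 2 = (parse_bits (mkseq inp i)).2, regs m 3 = cnt i &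
  [/\ ipos m = i, opos m = size (word q (cnt i)) & out_is (word q (cnt i)) (outp m)]].
have write v w s i o : s 5 = v -> out_is w o -> exists s' u,
    [/\ exec T inp (PWhile 5 (PDec 5 ;; POut true)) (Memory s i o (size w))
          (Memory s' i u (size (w ++ nseq v true))),
        out_is (w ++ nseq v true) u & forall j, j != 5 -> s' j = s j].
  elim: v w s o => [|v IH] w s o s5 ow'.
    by exists s, o; rewrite cats0; split=> //; apply: XDone.
  have [||s' [u [X Ow K]]] := IH (rcons w true) (upd s 5 v) (upd o (size w) (Some true)).
  - by rewrite updE.
  - exact: out_is_rcons.
  exists s', u; rewrite -cat_rcons in Ow *; split=> //; last first.
    by move=> j j5; rewrite K // updE (negbTE j5).
  rewrite size_rcons in X; apply: XLoop X; first by rewrite /= s5.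
  apply: XSeq (XDec _ _ _ _ _ _ _) _; rewrite s5; exact: XOut.
have stepI i m : Inv i m -> regs m 0 <> 0 /\ exists2 m', exec T inp body m m' & Inv i.+1 m'.
  case: m => s ip o a [/= s0 s1 s2 s3 [-> -> Ow]]; split; first by rewrite s0.
  have [t1 X1 [u1 u2 u0 u3]] := Hrd T inp s i o (size (word q (cnt i))) _ s1 s2.
  have epb : parse_bit (parse_bits (mkseq inp i)) (inp i) = parse_bits (mkseq inp i.+1).
    by rewrite mkseqS -cats1 parse_cat.
  rewrite epb -/(vals i.+1) in u1 u2.
  have [t2 X2 [v2 k2]] := H4 T inp t1; have [t3 X3 [v3 k3]] := H5 T inp t2.
  have e2 : t2 4 = pickle (psi (cnt i, rev (vals i.+1))).
    by rewrite v2 /= /regvar /= u1 u3 s3 -(eg (cnt i, vals i.+1)).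
  have e34 : t3 4 = t2 4 by rewrite k3.
  have [K0 K1 K2 K3] : [/\ t3 0 = 1, t3 1 = pickle (vals i.+1),
      t3 2 = (parse_bits (mkseq inp i.+1)).2 & t3 3 = cnt i].
    by rewrite !k3 // !k2 // u0 u1 u2 u3.
  have start m' : exec T inp (PWhile 4 (PWhile 5 (PDec 5 ;; POut true) ;;
      POut false ;; PInc 3 ;; clear 4)) (Memory t3 i.+1 o (size (word q (cnt i)))) m' ->
      exec T inp body (Memory s i o (size (word q (cnt i)))) m'.
    by move=> X; apply: XSeq X1 _; apply: XSeq (X2 _ _ _) _; apply: XSeq (X3 _ _ _) X.
  case e: (psi (cnt i, rev (vals i.+1))) e2 => [v|] e2; last first.
    exists (Memory t3 i.+1 o (size (word q (cnt i)))).
      by apply: start; apply: XDone; rewrite /= e34 e2.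
    by rewrite /Inv /= e.
  have e5 : t3 5 = v by rewrite v3 /= /regvar /= e2 pickle_some chd_cons.
  have ev : v = q (cnt i).
    by have [k ek _] := vals_mkseq i.+1; apply: (sound _ k); rewrite -ek.
  have [t4 [u4 [X4 O4 K4]]] := write _ _ _ i.+1 _ e5 Ow.
  have O5 := out_is_rcons false O4.
  have ew : rcons (word q (cnt i) ++ nseq v true) false = word q (cnt i).+1.
    by rewrite wordS rcons_cat ev.
  have es : (size (word q (cnt i) ++ nseq v true)).+1 = size (word q (cnt i).+1).
    by rewrite -ew size_rcons.
  rewrite ew in O5.
  pose t5 := upd (upd t4 3 (t4 3).+1) 4 0.
  exists (Memory t5 i.+1 (upd u4 (size (word q (cnt i) ++ nseq v true)) (Some false))
      (size (word q (cnt i).+1))); last first.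
    by rewrite /Inv /= e /t5 !updE /= !K4 // K0 K1 K2 K3.
  apply: start; apply: XLoop; first by rewrite /= e34 e2 pickle_some; move/eqP; rewrite ccons_neq0.
    apply: XSeq X4 _; apply: XSeq; first exact: XOut.
    rewrite es; apply: XSeq (XInc _ _ _ _ _ _ _) (runs_clear _ _ _ _ _ _ _).
  by apply: XDone.
have [x1 rx1 [l [el _]]] := tm_start (P := T) 0 inp (isT : 0 < size (IJmp 0 :: compile 1 prog)) Logic.I.
have I0 : Inv 0 (start_memory 0) by split=> //; split=> // n.
have cnt_mono i j : i <= j -> cnt i <= cnt j.
  move=> /subnKC <-; elim: (j - i) => [|k IH]; first by rewrite addn0.
  by rewrite addnS (leq_trans IH) //=; case: (psi _).
have cnt_unb n : exists i, n < cnt i.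
  elim: n => [|n [i ni]].
    have [k0 Hk] := live 0; have [k ek Hs] := vals_mkseq (size (word x k0)).+1.
    case: (posnP (cnt (size (word x k0)))) => c0; last by exists (size (word x k0)).
    exists (size (word x k0)).+1; rewrite /= c0 ek.
    by have := Hk k (Hs k0 (leqnSn _)); case: (psi _).
  have [k0 Hk] := live n.+1; pose j := maxn i (size (word x k0)).
  have [k ek Hs] := vals_mkseq j.+1.
  have ij : n < cnt j by rewrite (leq_trans ni) // cnt_mono // leq_maxl.
  case: (ltnP n.+1 (cnt j)) => nj; first by exists j.
  have c0 : cnt j = n.+1 by apply/eqP; rewrite eqn_leq nj ij.
  exists j.+1; rewrite /= c0 ek.
  by have := Hk k (Hs k0 (leqW (leq_maxr _ _))); case: (psi _).
move=> n; have [i ni] := cnt_unb n.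
have [k _ [[m [_ _ _ _ [_ _ Ow]] [W _ em]] _]] :=
  @exec_forever T inp _ 0 0 body 1 Inv _ x1 (code_at_prog prog) stepI Logic.I I0 rx1 i.
exists (k + l) => t kt; apply: one_way_stable kt _ => //.
rewrite addnC runD /run el em /= Ow ifT.
  by rewrite nth_word // (leq_trans ni) // size_word.
by rewrite (leq_trans ni) // size_word.
Qed.

(** After each input bit the machine writes its current guesses into as many cells as values have
    been read, and moves the output head back to cell 0. Guesses may be wrong for any finite time,
    but a cell whose guess has settled is only ever overwritten by the same symbol. *)
Lemma limit_machine (psi : nat * seq nat -> option bool) : pr psi ->
  exists M, forall x q,
    (forall n, exists k0, forall k, k0 <= k -> psi (n, mkseq x k) = Some (tape q n)) ->
    produces M x q.
Proof.
move=> Hpsi.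
(* A missing guess is written as 0; only the guesses from some stage on matter. *)
have [g Hg eg] : pr (fun p : nat * seq nat => psi (p.1, rev p.2) == Some true).
  apply: pr_eq (pr_const _ _); apply: (pr_app Hpsi).
  by apply: pr_pair; [|apply: pr_rev]; [apply/pr_fst/pr_id|apply/pr_snd/pr_id].
have [gs Hgs egs] := pr_size (pr_id (seq nat : countType)).
have Hg4 : npr (fun e => g (ccons (e 3) (ccons (e 1) 0))).
  apply: npr_app1 Hg _; do ?apply: (npr_app2 npr2_cons); try exact: npr_var.
  exact: npr_const.
have [prd _ Hrd] := read_bitP.
have [p4 _ H4] := @assignP _ 7 4 Hg4 isT.
have [p5 _ H5] := @assignP _ 7 5 (npr_app1 npr1_eq0 (npr_var 4)) isT.
have [p6 _ H6] := @assignP _ 7 6 (npr_app1 Hgs (npr_var 1)) isT.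
pose inner := PWhile 6 (PDec 6 ;; p4 ;; p5 ;; PWhile 4 (PDec 4 ;; POut true) ;;
  PWhile 5 (PDec 5 ;; POut false) ;; PInc 3).
pose rewind := PWhile 3 (PDec 3 ;; PLeft).
pose body := prd ;; p6 ;; clear 3 ;; inner ;; rewind.
pose prog := PWhile 0 body.
exists (tm (IJmp 0 :: compile 1 prog) 0) => x q live.
pose inp := tape x.
pose vals i := (parse_bits (mkseq inp i)).1.
have vals_mkseq i : exists2 k, rev (vals i) = mkseq x k &
    forall m, size (word x m) <= i -> m <= k.
  by have [k e H] := parse_tape x i; exists k => //; rewrite /vals e revK.
pose bit i n := psi (n, rev (vals i)) == Some true.
pose Inv i m := [/\ regs m 0 = 1, regs m 1 = pickle (vals i),
  regs m 2 = (parse_bits (mkseq inp i)).2, ipos m = i & opos m = 0].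
have stage (P : (nat -> option bool) -> Prop) i m : Inv i m -> P (outp m) ->
    (forall o j, P o -> j < size (vals i.+1) -> P (upd o j (Some (bit i.+1 j)))) ->
    exists2 m', exec P inp body m m' & Inv i.+1 m' /\
      outp m' = (fun n => if n < size (vals i.+1) then Some (bit i.+1 n) else outp m n).
  case: m => s ip o a [/= s0 s1 s2 -> ->] Po Pupd.
  have [t1 X1 [u1 u2 u0 u3]] := Hrd P inp s i o 0 _ s1 s2.
  have epb : parse_bit (parse_bits (mkseq inp i)) (inp i) = parse_bits (mkseq inp i.+1).
    by rewrite mkseqS -cats1 parse_cat.
  rewrite epb -/(vals i.+1) in u1 u2.
  have [t2 X2 [v2 k2]] := H6 P inp t1.
  pose B := size (vals i.+1).
  have e6 : t2 6 = B by rewrite v2 /= /regvar /= u1 egs.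
  pose ot k n := if n < k then Some (bit i.+1 n) else o n.
  have otS k : upd (ot k) k (Some (bit i.+1 k)) = ot k.+1.
    by apply/funext => n; rewrite updE /ot ltnS; case: ltngtP => // ->.
  pose J k m := [/\ k <= B, regs m 6 = k,
    [/\ regs m 3 = B - k, regs m 0 = 1, regs m 1 = pickle (vals i.+1) &
      regs m 2 = (parse_bits (mkseq inp i.+1)).2] &
    [/\ ipos m = i.+1, opos m = B - k, P (outp m) & outp m = ot (B - k)]].
  have J0 m : J 0 m -> regs m 6 = 0 by case.
  have JS k m : J k.+1 m -> regs m 6 <> 0 /\ exists2 m', exec P inp
      (PDec 6 ;; p4 ;; p5 ;; PWhile 4 (PDec 4 ;; POut true) ;;
       PWhile 5 (PDec 5 ;; POut false) ;; PInc 3) m m' & J k m'.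
    case: m => r ip' w a' [/= kB r6 [r3 r0 r1 r2] [-> -> Pw ew]]; split; first by rewrite r6.
    have kS : B - k = (B - k.+1).+1 by rewrite subnSK.
    have jB : B - k.+1 < B by rewrite ltn_subrL (leq_ltn_trans _ kB).
    have [w1 Y1 [f1 h1]] := H4 P inp (upd r 6 (r 6).-1).
    have [w2 Y2 [f2 h2]] := H5 P inp w1.
    have bt : w1 4 = bit i.+1 (B - k.+1).
      rewrite f1 /= /regvar /= !updE /= r3 r1.
      exact: (eg (B - k.+1, vals i.+1)).
    have bf : w2 5 = ~~ bit i.+1 (B - k.+1).
      by rewrite f2 /= /regvar /= bt eqb0.
    have bt' : w2 4 = bit i.+1 (B - k.+1) by rewrite h2.
    have Pw' := Pupd _ _ Pw jB; have ew' := ew; rewrite ew otS -kS in Pw'.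
    pose w3 := if bit i.+1 (B - k.+1) then upd w2 4 0 else upd w2 5 0.
    exists (Memory (upd w3 3 (w3 3).+1) i.+1 (ot (B - k)) (B - k)).
      apply: XSeq (XDec _ _ _ _ _ _ _) _; apply: XSeq (Y1 _ _ _) _.
      apply: XSeq (Y2 _ _ _) _; rewrite /w3 ew.
      move: bt' bf Pw'; rewrite kS -otS; case: (bit _ _) => bt' bf Pw'.
        apply: (@XSeq _ _ _ _ _ (Memory (upd w2 4 0) i.+1
          (upd (ot (B - k.+1)) (B - k.+1) (Some true)) (B - k.+1).+1)).
          apply: XLoop; first by rewrite /= bt'.
            by apply: XSeq (XDec _ _ _ _ _ _ _) _; rewrite bt'; apply: XOut.
          by apply: XDone.
        by apply: XSeq; [apply: XDone; rewrite /= updE /= bf|apply: XInc].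
      apply: XSeq; first by apply: XDone; rewrite /= bt'.
      apply: (@XSeq _ _ _ _ _ (Memory (upd w2 5 0) i.+1
        (upd (ot (B - k.+1)) (B - k.+1) (Some false)) (B - k.+1).+1)).
        apply: XLoop; first by rewrite /= bf.
          by apply: XSeq (XDec _ _ _ _ _ _ _) _; rewrite bf; apply: XOut.
        by apply: XDone.
      exact: XInc.
    have w3E j : j != 4 -> j != 5 -> w3 j = w2 j.
      by move=> j4 j5; rewrite /w3; case: (bit _ _); rewrite updE ?(negbTE j4) ?(negbTE j5).
    split=> //=; first exact: ltnW.
      by rewrite updE /= w3E // h2 // h1 // updE r6.
    by rewrite !updE /= !w3E // !h2 // !h1 // !updE /= r3 r0 r1 r2 kS.
  have JB : J B (Memory (upd t2 3 0) i.+1 o 0).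
    split=> //=; first by rewrite !updE /= subnn !k2 // u0 u1 u2.
    by split=> //; rewrite ?subnn // /ot; apply/funext => n; rewrite ltn0.
  have [[r ip' w a'] X3 [_ _ [/= r3 r0 r1 r2] [/= ei ea Pw ew]]] := exec_for J0 JS JB.
  subst ip' a'.
  rewrite subn0 in X3 r3 ew.
  pose J' k m := [/\ regs m 3 = k, opos m = k,
    [/\ regs m 0 = 1, regs m 1 = pickle (vals i.+1) &
      regs m 2 = (parse_bits (mkseq inp i.+1)).2] & ipos m = i.+1 /\ outp m = w].
  have J'0 m : J' 0 m -> regs m 3 = 0 by case.
  have J'S k m : J' k.+1 m -> regs m 3 <> 0 /\ exists2 m',
      exec P inp (PDec 3 ;; PLeft) m m' & J' k m'.
    case: m => r' jp w' a'' [/= r'3 -> [h0 h1 h2] [-> ->]]; split; first by rewrite r'3.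
    exists (Memory (upd r' 3 k) i.+1 w k); last by split.
    by apply: XSeq (XDec _ _ _ _ _ _ _) _; rewrite r'3; exact: (XLeft P inp _ _ _ k.+1).
  have J'B : J' B (Memory r i.+1 w B) by split.
  have [[r' jp w' a''] X4 [_ /= ea' [h0 h1 h2] [/= ej eo]]] := exec_for J'0 J'S J'B.
  subst jp w' a''.
  exists (Memory r' i.+1 w 0).
    apply: XSeq X1 _; apply: XSeq (X2 _ _ _) _.
    by apply: XSeq (runs_clear _ _ _ _ _ _ _) _; apply: XSeq X3 X4.
  by split; [split|rewrite /= ew].
move=> n; have [k0 Hk] := live n; pose i0 := size (word x (maxn k0 n.+1)).
have late i : i0 <= i -> n < size (vals i) /\ psi (n, rev (vals i)) = Some (tape q n).
  move=> ii; have [k ek Hs] := vals_mkseq i.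
  have := Hs _ ii; rewrite geq_max => /andP[kk nk].
  by rewrite ek Hk // -(size_rev (vals i)) ek size_mkseq.
have late_bit i : i0 <= i -> bit i n = tape q n.
  by move=> /late[_ e]; rewrite /bit e; case: tape.
pose T := fun _ : nat -> option bool => True.
pose Inv1 i m := Inv i m /\ (i0 < i -> outp m n = Some (tape q n)).
have step1 i m : Inv1 i m -> regs m 0 <> 0 /\
    exists2 m', exec T inp body m m' & Inv1 i.+1 m'.
  move=> [Im _]; split; first by case: Im => ->.
  have [m' X [Im' eo]] := stage T i m Im Logic.I (fun _ _ _ _ => Logic.I).
  exists m' => //; split=> // ii; rewrite eo /= late_bit ?(ltnW ii) // ifT //.
  by have [] := late i.+1 (ltnW ii).
have [x1 rx1 [l [el _]]] := tm_start (P := T) 0 inp (isT : 0 < size (IJmp 0 :: compile 1 prog)) Logic.I.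
have I0 : Inv1 0 (start_memory 0) by split.
have [k _ [[m [Im om] rm] _]] :=
  @exec_forever T inp _ 0 0 body 1 Inv1 _ x1 (code_at_prog prog) step1 Logic.I I0 rx1 i0.+1.
(* The first run, with the trivial [T], reached a round after which cell [n] is correct. A second
   run starts there with [P], which controls the cell also in the middle of the later rounds. *)
pose P (o : nat -> option bool) := o n = Some (tape q n).
have step2 i m' : Inv (i0.+1 + i) m' /\ P (outp m') -> regs m' 0 <> 0 /\
    exists2 m'', exec P inp body m' m'' & Inv (i0.+1 + i.+1) m'' /\ P (outp m'').
  move=> [Im' Pm']; split; first by case: Im' => ->.
  have [|m'' X [Im'' eo]] := stage P _ m' Im' Pm'.
    move=> o j Po jlt; rewrite /P updE; case: eqP => // <-.
    by rewrite late_bit // -addnS addSn -addnS leq_addr.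
  exists m'' => //; rewrite addnS; split=> //; exact: (exec_out X).
have ilim t : k <= t -> P (out (iter t (stp (tm (IJmp 0 :: compile 1 prog) 0) inp) x1)).
  move=> kt; set y := iter k _ x1 in rm.
  have Im0 : Inv (i0.+1 + 0) m /\ P (outp m) by rewrite addn0; split; last exact: om.
  have [k' kk' [_ H]] := @exec_forever P inp _ 0 0 body 1 _ _ y (code_at_prog prog)
    step2 (om (ltnSn _)) Im0 rm (t - k).
  by rewrite -(subnK kt) iterD; apply: H.
exists (k + l) => t kt; have lt : l <= t by rewrite (leq_trans _ kt) ?leq_addl.
by rewrite -(subnKC lt) runD /run el; apply: ilim; rewrite leq_subRL // addnC.
Qed.

(** * Universal statements as questions to the halting problem *)

Lemma pr_tm code : pr (tm code).
Proof.
have Hs : forall A : countType, forall f : A -> nat, pr f -> pr (fun a => ramp_state code (f a)).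
  by move=> A f Hf; apply: pr_addn => //; exact: pr_const.
have entry (A : countType) (q q' : A -> nat) b w m : pr q -> pr q' ->
    pr (fun a => ((q a, b, 0, None), (q' a, w, None, (Stay, m, Stay))) : scan * action).
  by move=> Hq Hq'; do ?apply: pr_pair => //; exact: pr_const.
apply: pr_cat.
  by apply: pr_cons; [|apply: pr_cons; [|exact: pr_nil]];
    apply: (entry nat (fun=> 0) (ramp_state code)); try exact: pr_const; apply: (Hs nat id); exact: pr_id.
apply: (@pr_rec nat (seq (scan * action) : countType) id (fun=> ramp_last code ++ table code)
  (fun _ i M => ramp_entry code i ++ M)); [|exact: pr_id|exact: pr_const].
apply: pr_cat; last exact/pr_snd/pr_id.
have Hi : pr (fun q : nat * nat * seq (scan * action) => q.1.2) by apply/pr_snd/pr_fst/pr_id.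
by apply: pr_cons; [|apply: pr_cons; [|exact: pr_nil]];
  apply: entry; apply: Hs => //; apply: pr_succ.
Qed.

(** The machine with parameter [c] searches for an [s] with [chi (c, s)] and halts when it finds
    one. Only the boot part of its table depends on [c], so its index is a primitive recursive
    function of [c], an instance of the parameter theorem. *)
Lemma halting_index (chi : nat * nat -> bool) : pr chi ->
  exists2 h : nat -> nat, pr h &
    forall c, halting_problem (h c) = 0 <-> forall s, ~~ chi (c, s).
Proof.
(* The predecessor undoes the shift of register 0, which holds [c.+1]. *)
move=> Hchi; have [g Hg eg] : pr (fun p : nat * nat => ~~ chi (p.1.-1, p.2)).
  apply: pr_neg; apply: (pr_app Hchi); apply: pr_pair; last exact/pr_snd/pr_id.
  exact/pr_pred/pr_fst/pr_id.
have Hg2 : npr (fun e => g (ccons (e 0) (ccons (e 1) 0))).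
  apply: npr_app1 Hg _; do ?apply: (npr_app2 npr2_cons); try exact: npr_var.
  exact: npr_const.
have [p _ Hp] := @assignP _ 3 2 Hg2 isT.
(* Register 1 is the candidate [s]. Register 2 is nonzero while the search goes on; the initial
   [PInc 2] lets the loop start. *)
pose body := p ;; PInc 1.
pose prog := PInc 2 ;; PWhile 2 body.
pose code := IJmp 0 :: compile 1 prog.
exists (fun c => pickle (tm code c)); first exact: pr_pickle (pr_tm code).
move=> c; rewrite /halting_problem /nth_machine pickleK [odflt _ _]/=.
pose inp := tape zero_seq; pose T := fun _ : nat -> option bool => True.
have [x1 rx1 [l [el _]]] := tm_start (P := T) c inp (isT : 0 < size code) Logic.I.
have at1 : code_at code 1 (compile 1 prog) := code_at_prog prog.
have [_ at2] : code_at code 1 [:: IInc 2] /\ code_at code 2 (compile 2 (PWhile 2 body)) :=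
  code_at_cat at1.
have stepb m : regs m 0 = c.+1 -> exists2 m', exec T inp body m m' &
    [/\ regs m' 0 = c.+1, regs m' 1 = (regs m 1).+1 & regs m' 2 = ~~ chi (c, regs m 1)].
  case: m => s i o a /= s0; have [s' X [v k]] := Hp T inp s.
  exists (Memory (upd s' 1 (s' 1).+1) i o a).
    by apply: XSeq (X _ _ _) (XInc _ _ _ _ _ _ _).
  split=> /=; rewrite updE /=; try by rewrite k.
  by rewrite v /= /regvar /= s0; exact: (eg (c.+1, s 1)).
pose m1 := Memory (upd (regs (start_memory c)) 2 1) 0 (fun=> None) 0.
have e1 : exec T inp (PInc 2) (start_memory c) m1 by exact: XInc.
have [at1' _] := code_at_cat at1.
have [x2 rx2 [l2 [el2 _]]] := compile_correct c e1 at1' Logic.I rx1.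
have run_x2 d : run (tm code c) inp (l + (l2 + d)) = iter d (stp (tm code c) inp) x2.
  by rewrite runD /run el addnC iterD el2.
case: asboolP => [[t ht]|nh]; [split=> // H|split=> // _ s].
  (* A machine halted at time [t] keeps its configuration, but the unending loop is at its test at
     some later time, where a step is possible. *)
  exfalso; pose Inv i m := [/\ regs m 0 = c.+1, regs m 1 = i & regs m 2 <> 0].
  have stepI i m : Inv i m -> regs m 2 <> 0 /\ exists2 m', exec T inp body m m' & Inv i.+1 m'.
    move=> [h0 hi h2]; split=> //; have [m' X [k0 k1 k2]] := stepb m h0.
    by exists m' => //; split=> //; rewrite ?k1 ?hi // k2 H.
  have I0 : Inv 0 m1 by split.
  have stuck d : run (tm code c) inp (t + d) = run (tm code c) inp t.
    by rewrite runD; elim: d => // d IH; rewrite iterS IH /stp ht.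
  have [k kt [[m _ [W sW em]] _]] :=
    @exec_forever T inp code c 2 body 2 Inv _ x2 at2 stepI Logic.I I0 rx2 t.
  have := run_x2 k; rewrite em => ek.
  have tk : t <= l + (l2 + k) by rewrite (leq_trans kt) // addnA leq_addl.
  have [W0 _ _] := sW 0; have [lt2 _ _] := code_at_head at2.
  move: ht; rewrite -(stuck (l + (l2 + k) - t)) subnKC // ek.
  by rewrite (stepE (a := delta code (st 2 0, inp (ipos m), W 0, outp m (opos m)))) // lookup_tm_st.
apply/negP => cs; apply: nh; have [s0 cs0 min0] := ex_minnP (ex_intro (fun s => chi (c, s)) s cs).
pose J k m := if k is k'.+1 then [/\ regs m 2 <> 0, regs m 0 = c.+1 & regs m 1 + k' = s0]
  else regs m 2 = 0.
have JS k m : J k.+1 m -> regs m 2 <> 0 /\ exists2 m', exec T inp body m m' & J k m'.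
  move=> [h2 h0 h1]; split=> //; have [m' X [k0 k1 k2]] := stepb m h0.
  exists m' => //; case: k h1 => [|k] h1 /=; first by rewrite k2 -(addn0 (regs m 1)) h1 cs0.
  rewrite k0 k1 k2; split=> //; last by rewrite -h1 addSnnS.
  by case e: (chi _) => //; have := min0 _ e; rewrite -h1 -[X in _ <= X]addn0 leq_add2l.
have J0 : J s0.+1 m1 by split.
have [m' X _] := exec_for (fun m (h : J 0 m) => h) JS J0.
have [x3 rx3 [l3 [el3 _]]] := compile_correct c X at2 Logic.I rx2.
exists (l + (l2 + l3)); rewrite run_x2 el3; have [W _ ->] := rx3.
rewrite /step /= (_ : 2 + _ = size code); last by [].
by rewrite lookup_tm_end.
Qed.

(** * Universal simulation *)

(** A list of numbers is pickled by [CodeSeq.code], the inverse of [CodeSeq.decode], so on codes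
    decoding is the identity. *)
Lemma pr_decode (A : countType) (f : A -> nat) : pr f -> pr (fun a => CodeSeq.decode (f a)).
Proof.
move=> [f' Hf ef]; exists f' => // a; rewrite ef.
by rewrite -[RHS]/(CodeSeq.code (map id _)) map_id CodeSeq.decodeK.
Qed.

Lemma pr_pmap (A B C : countType) (f : B -> option C) (l : A -> seq B) :
  pr f -> pr l -> pr (fun a => pmap f (l a)).
Proof.
move=> Hf Hl.
have H : pr (fun q : A * B * seq C => if f q.1.2 is Some y then y :: q.2 else q.2).
  apply: pr_match_option; last exact/pr_snd/pr_id.
    by apply: pr_cons; [|apply/pr_snd/pr_fst]; [apply/pr_snd|]; exact: pr_id.
  by apply: (pr_app Hf); apply/pr_snd/pr_fst/pr_id.
apply: pr_ext (pr_foldr (f := fun _ x s => if f x is Some y then y :: s else s)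
  H (pr_nil _ _) Hl) _ => a.
by elim: (l a) => //= x s ->; case: (f x).
Qed.

(** The enumeration of machines unpickles arbitrary numbers, including those that are no codes, and
    on these [pr] alone gives no information. *)
Definition decodable (T : countType) : Prop := pr (@unpickle T).

Lemma decodable_nat : decodable nat.
Proof. by apply: pr_some; exact: pr_id. Qed.

Lemma decodable_bool : decodable bool.
Proof. by apply: (pr_ext (f := fun n => Some (odd n))) => //; apply/pr_some/pr_odd/pr_id. Qed.

Lemma decodable_option (T : countType) : decodable T -> decodable (option T).
Proof.
move=> HT; apply: (pr_ext (f := fun n => Some (ohead (pmap (@unpickle T) (CodeSeq.decode n))))) => //.
by apply/pr_some/pr_ohead/(pr_pmap HT)/pr_decode/pr_id.
Qed.

Lemma decodable_seq (T : countType) : decodable T -> decodable (seq T).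
Proof. by move=> HT; apply/pr_some/(pr_pmap HT)/pr_decode/pr_id. Qed.

Lemma decodable_pair (T U : countType) : decodable T -> decodable U -> decodable (T * U)%type.
Proof.
move=> HT HU.
pose f n : option (T * U) := let s := CodeSeq.decode n in
  if size s == 2 then
    if unpickle (nth 0 s 0) is Some x then
      if unpickle (nth 0 s 1) is Some y then Some (x, y) else None
    else None
  else None.
apply: (pr_ext (f := f)); last first.
  move=> n; rewrite /f.
  rewrite -[RHS]/(omap (@pair_of_tag T U) (@unpickle_tagged T (fun=> U) n)).
  rewrite /unpickle_tagged.
  case: (CodeSeq.decode n) => [|a [|b [|c s]]] //=.
  by case: (unpickle a) => //= x; case: (unpickle b).
have Hd : pr CodeSeq.decode by apply: pr_decode (pr_id _).
apply: pr_if; [|apply: pr_match_option|exact: pr_const]; last exact: pr_const.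
- by apply: pr_eq (pr_size Hd) (pr_const _ _).
- apply: pr_match_option; last exact: pr_const.
    by apply/pr_some/pr_pair; [apply/pr_snd/pr_fst/pr_id|apply/pr_snd/pr_id].
  by apply: (pr_app HU); apply: pr_nth; 
    [exact: pr_const|apply: pr_app Hd _; apply/pr_fst/pr_id|exact: pr_const].
- by apply: (pr_app HT); apply: pr_nth; [exact: pr_const|exact: Hd|exact: pr_const].
Qed.

Lemma decodable_move : decodable move.
Proof.
have Hd : pr move_decode.
  by exists id => [|b]; [exact: npr_var|case: b => [[]|]].
apply: (pr_ext (f := fun n => if unpickle n is Some b then Some (move_decode b) else None)).
  apply: (@pr_match_option nat (option bool) (option move) (fun n => unpickle n)
    (fun _ b => Some (move_decode b)) (fun=> None));
    [|exact: decodable_option decodable_bool|exact: pr_const].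
  by apply/pr_some/(pr_app Hd)/pr_snd/pr_id.
by [].
Qed.

Lemma pr_nth_machine (A : countType) (f : A -> nat) : pr f -> pr (fun a => nth_machine (f a)).
Proof.
move=> Hf; apply: (pr_app (g := nth_machine) _ Hf).
have D : decodable machine.
  apply/decodable_seq/decodable_pair; do ?apply: decodable_pair;
    try exact: decodable_nat; try exact: decodable_bool; try exact: decodable_move;
    exact: decodable_option decodable_bool.
apply: (@pr_match_option nat machine machine unpickle (fun _ M => M)) _ D
  (pr_const _ ([::] : machine)).
by apply: pr_snd; apply: pr_id.
Qed.

(** Tapes are represented by the list of all writes, the latest one first. *)
Definition tape_get (T : Type) (d : T) (l : seq (nat * T)) (i : nat) : T :=
  foldr (fun p r => if p.1 == i then p.2 else r) d l.

Definition sconf : Type :=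
  nat * nat * seq (nat * nat) * nat * seq (nat * option bool) * nat.

Definition sinit : sconf := (0, 0, [::], 0, [::], 0).

Definition conf (c : sconf) : config :=
  let: (q, ip, W, wp, Ow, op) := c in
  Config q ip (tape_get 0 W) wp (tape_get None Ow) op.

Definition sstep (M : machine) (X : seq bool) (c : sconf) : option sconf :=
  let W := c.1.1.1.2 in let Ow := c.1.2 in
  if lookup M (c.1.1.1.1.1, nth false X c.1.1.1.1.2, tape_get 0 W c.1.1.2, tape_get None Ow c.2) is Some a
  then Some (a.1.1.1, Defs.shift a.2.1.1 c.1.1.1.1.2, (c.1.1.2, a.1.1.2) :: W,
    Defs.shift a.2.1.2 c.1.1.2, (c.2, a.1.2) :: Ow, Defs.shift a.2.2 c.2)
  else None.

Definition sim (M : machine) (X : seq bool) (t : nat) : sconf :=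
  iter t (fun c => odflt c (sstep M X c)) sinit.

Lemma sstepE M X c : omap conf (sstep M X c) = step M (nth false X) (conf c).
Proof.
case: c => [[[[[q ip] W] wp] Ow] op]; rewrite /sstep /step /=.
case: (lookup _ _) => [[[[q' w] o] [[mi mw] mo]]|] //=.
by congr (Some (Config _ _ _ _ _ _)); apply/funext => n /=; rewrite eq_sym.
Qed.

Lemma simE M X t : run M (nth false X) t = conf (sim M X t).
Proof.
elim: t => // t IH; rewrite /run iterS -/(run _ _ _) IH -sstepE /sim iterS.
by case: (sstep M X _).
Qed.

Lemma out_sim M X t n :
  tape_get None (sim M X t).1.2 n = out (run M (nth false X) t) n.
Proof. by rewrite simE; case: (sim M X t) => [[[[[q ip] W] wp] Ow] op]. Qed.

Lemma pr_tape_get (A T : countType) (d : T) (l : A -> seq (nat * T)) (i : A -> nat) :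
  pr l -> pr i -> pr (fun a => tape_get d (l a) (i a)).
Proof.
move=> Hl Hi; apply: (pr_foldr (f := fun a p r => if p.1 == i a then p.2 else r) _ (pr_const _ _) Hl).
apply: pr_if; last exact/pr_snd/pr_id.
  by apply: pr_eq; [apply/pr_fst/pr_snd/pr_fst/pr_id|apply: (pr_app Hi); apply/pr_fst/pr_fst/pr_id].
exact/pr_snd/pr_snd/pr_fst/pr_id.
Qed.

Lemma pr_lookup (A : countType) (M : A -> machine) (k : A -> scan) :
  pr M -> pr k -> pr (fun a => lookup (M a) (k a)).
Proof.
move=> HM Hk.
have H : pr (fun q : A * (scan * action) * option action =>
    if q.1.2.1 == k q.1.1 then Some q.1.2.2 else q.2).
  apply: pr_if; last exact/pr_snd/pr_id.
    by apply: pr_eq; [apply/pr_fst/pr_snd/pr_fst/pr_id|apply: (pr_app Hk); apply/pr_fst/pr_fst/pr_id].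
  exact/pr_some/pr_snd/pr_snd/pr_fst/pr_id.
apply: pr_ext (pr_foldr (f := fun a e r => if e.1 == k a then Some e.2 else r)
  H (pr_const _ None) HM) _ => a.
by rewrite /lookup; elim: (M a) => //= e s IH; case: ifP.
Qed.

Lemma pr_shift (A : countType) (m : A -> move) (i : A -> nat) :
  pr m -> pr i -> pr (fun a => Defs.shift (m a) (i a)).
Proof.
move=> Hm Hi.
apply: (pr_ext (f := fun a => if m a == MoveL then (i a).-1 else if m a == MoveR then (i a).+1 else i a)).
  by apply: pr_if; [apply: pr_eq Hm (pr_const _ _)|apply: pr_pred|apply: pr_if => //;
    [apply: pr_eq Hm (pr_const _ _)|apply: pr_succ]].
by move=> a; case: (m a).
Qed.

Lemma pr_sstep (A : countType) (M : A -> machine) (X : A -> seq bool) (c : A -> sconf) :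
  pr M -> pr X -> pr c -> pr (fun a => sstep (M a) (X a) (c a)).
Proof.
move=> HM HX Hc.
have Hq : pr (fun a => (c a).1.1.1.1.1) by do 5!apply: pr_fst.
have Hip : pr (fun a => (c a).1.1.1.1.2) by apply: pr_snd; do 4!apply: pr_fst.
have HW : pr (fun a => (c a).1.1.1.2) by apply: pr_snd; do 3!apply: pr_fst.
have Hwp : pr (fun a => (c a).1.1.2) by apply: pr_snd; do 2!apply: pr_fst.
have HO : pr (fun a => (c a).1.2) by apply: pr_snd; apply: pr_fst.
have Hop : pr (fun a => (c a).2) by apply: pr_snd.
have up (B : countType) (g : A -> B) : pr g -> pr (fun p : A * action => g p.1).
  by move=> Hg; apply: (pr_app Hg); apply/pr_fst/pr_id.
apply: pr_match_option (pr_const _ _); last first.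
  apply: pr_lookup => //; do 3?apply: pr_pair => //; try exact: pr_tape_get.
  by apply: pr_nth => //; exact: pr_const.
have Ha : pr (fun p : A * action => p.2) by apply/pr_snd/pr_id.
apply: pr_some; do 5?apply: pr_pair.
- by do 3?apply: pr_fst.
- by apply: pr_shift; [do 2?apply: pr_fst; apply: pr_snd|apply: (up _ _ Hip)].
- by apply: pr_cons; [apply: pr_pair; [exact: (up _ _ Hwp)|apply: pr_snd; do 2?apply: pr_fst]|exact: (up _ _ HW)].
- by apply: pr_shift; [apply: pr_snd; apply: pr_fst; apply: pr_snd|apply: (up _ _ Hwp)].
- by apply: pr_cons; [apply: pr_pair; [exact: (up _ _ Hop)|apply: pr_snd; apply: pr_fst]|exact: (up _ _ HO)].
- by apply: pr_shift; [do 2?apply: pr_snd|apply: (up _ _ Hop)].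
Qed.

Lemma pr_sim (A : countType) (M : A -> machine) (X : A -> seq bool) (t : A -> nat) :
  pr M -> pr X -> pr t -> pr (fun a => sim (M a) (X a) (t a)).
Proof.
move=> HM HX Ht.
apply: (pr_iter (s := fun a c => odflt c (sstep (M a) (X a) c)) _ Ht (pr_const _ _)).
apply: pr_match_option; [exact/pr_snd/pr_id| |exact/pr_snd/pr_id].
apply: pr_sstep; last exact/pr_snd/pr_id.
  by apply: (pr_app HM); apply/pr_fst/pr_id.
by apply: (pr_app HX); apply/pr_fst/pr_id.
Qed.

(** The input head moves at most one cell per step, so [t] steps depend on the first [t] cells
    only. *)
Lemma run_ext M inp inp' t : (forall i, i < t -> inp i = inp' i) -> run M inp t = run M inp' t.
Proof.
move=> H; have ip s : in_pos (run M inp s) <= s.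
  elim: s => // s; rewrite /run iterS -/(run _ _ _); move: (run M inp s) => c ic.
  rewrite /step; case: (lookup _ _) => [[[[q w] o] [[mi mw] mo]]|] /=; last exact: leqW.
  by case: mi => /=; lia.
elim: t H => // t IH H; rewrite /run !iterS -!/(run _ _ _) -IH => [|i it]; last exact/H/ltnW.
by rewrite /step H // ltnS.
Qed.

Definition words (l : seq nat) : seq bool :=
  flatten [seq rcons (nseq v true) false | v <- l].

Lemma word_words q n : word q n = words (mkseq q n).
Proof. by rewrite /word /words /mkseq -map_comp. Qed.

Lemma pr_words (A : countType) (l : A -> seq nat) : pr l -> pr (fun a => words (l a)).
Proof.
move=> Hl; apply: pr_flatten.
apply: (pr_map (f := fun _ v => rcons (nseq v true) false) _ Hl).
apply: pr_rcons (pr_const _ _).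
by apply: pr_nseq; [exact: pr_const|apply/pr_snd/pr_id].
Qed.

(** * From the halting problem to limit computations *)

(** The empty list stands for the input 000..., since cells beyond the list read as [false]. *)
Definition halted (i s : nat) : bool :=
  sstep (nth_machine i) [::] (sim (nth_machine i) [::] s) == None.

Lemma tape_zero : tape zero_seq = nth false [::].
Proof.
have H n : word zero_seq n = nseq n false.
  by elim: n => // n IH; rewrite wordS IH -[in RHS]addn1 nseqD.
apply/funext => i; rewrite -[tape _ _]/(nth false (word zero_seq i.+1) i) H.
by rewrite nth_nseq if_same nth_nil.
Qed.

(** A machine that has halted stays so; hence the approximation changes at most once, from 0 to
    1. *)
Lemma halted_lim i : exists s0, forall s, s0 <= s -> halted i s = halting_problem i :> nat.
Proof.
have E s : halted i s = ~~ step (nth_machine i) (tape zero_seq)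
    (run (nth_machine i) (tape zero_seq) s).
  by rewrite tape_zero simE -sstepE /halted; case: (sstep _ _ _).
rewrite /halting_problem; case: asboolP => [[t ht]|nh].
  exists t => s ts; rewrite E (_ : run _ _ s = run (nth_machine i) (tape zero_seq) t) ?ht //.
  rewrite -(subnKC ts) runD; elim: (s - t) => // d IH.
  by rewrite iterS IH /stp ht.
by exists 0 => s _; rewrite E; case e: (step _ _ _) => //; case: nh; exists s.
Qed.

Lemma relative_limit F : computable_relative_to halting_problem F -> limit_computable F.
Proof.
move=> [G [M M1 HM] HG].
(* A prefix of the input of [G], with the oracle replaced by its approximation at stage
   [size vs]. *)
pose jl vs := mkseq (fun i => if odd i then nth 0 vs i./2 else halted i./2 (size vs))
  (2 * size vs).
pose psi (a : nat * seq nat) : option bool := tape_get None (sim M (words (jl a.2)) (size a.2)).1.2 a.1.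
have Hvs : pr (fun q : nat * seq nat * nat => q.1.2) by apply/pr_snd/pr_fst/pr_id.
have Hi : pr (fun q : nat * seq nat * nat => q.2) by apply/pr_snd/pr_id.
have Hsz : pr (fun a : nat * seq nat => size a.2) by apply/pr_size/pr_snd/pr_id.
have Hpsi : pr psi.
  apply: pr_tape_get (pr_fst (pr_id _)); apply/pr_snd/pr_fst/pr_sim => //; first exact: pr_const.
  apply: pr_words; apply: (pr_mkseq (f := fun a i =>
    if odd i then nth 0 a.2 i./2 else halted i./2 (size a.2))); last first.
    by apply: pr_muln => //; exact: pr_const.
  apply: pr_if; first exact: pr_odd.
    by apply: pr_nth; [exact: pr_const|exact: Hvs|exact: pr_half].
  apply: pr_if; try exact: pr_const.
  have Hm : pr (fun q : nat * seq nat * nat => nth_machine q.2./2).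
    by apply: pr_nth_machine; exact: pr_half.
  apply: pr_eq (pr_const _ _); apply: pr_sstep => //; first exact: pr_const.
  apply: pr_sim => //; first exact: pr_const; exact: pr_size.
have [M' HM'] := limit_machine Hpsi; exists M' => p q Fpq; apply: HM' => n.
have [t0 Ht0] := HM _ _ (HG _ _ Fpq) n.
(* Cell [n] of the output is written within [t0] steps, which involve input blocks below [t0] only;
   so finitely many oracle values have to settle. *)
have [K HK] : exists K, forall k i, K <= k -> i < t0 -> halted i k = halting_problem i :> nat.
  elim: (t0) => [|N [K HK]]; first by exists 0.
  have [s0 Hs0] := halted_lim N; exists (maxn K s0) => k i; rewrite geq_max ltnS [i <= N]leq_eqVlt.
  by move=> /andP[Kk sk] /orP[/eqP->|iN]; [exact: Hs0|exact: HK].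
exists (maxn K t0) => k; rewrite geq_max => /andP[Kk tk].
rewrite /psi /= size_mkseq; set X := words _.
rewrite out_sim.
pose jk := join (fun i => halted i k) p.
have eX : X = word jk (2 * k).
  rewrite word_words /X /jl size_mkseq; congr words; apply/eq_in_map => i.
  rewrite mem_iota add0n => ik; rewrite /jk /join; case: ifP => // _.
  by rewrite nth_mkseq // ltn_half_double -mul2n.
(* The values beyond the first [t0] blocks may still be wrong, and the run may go astray after [t0];
   one-way output keeps what has been written. *)
apply: (one_way_stable M1 tk).
rewrite -(Ht0 t0 (leqnn _)); congr (out _ n); apply: run_ext => i it0.
have w t : t0 <= size (word t t0) by exact: size_word.
rewrite eX (@word_prefix _ t0) ?(leq_trans it0) //; last by rewrite (leq_trans tk) // leq_pmull.
rewrite -(@nth_word _ t0) ?(leq_trans it0) //; congr nth.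
rewrite !word_words; congr words; apply/eq_in_map => j; rewrite mem_iota add0n => jt0.
rewrite /jk /join; case: ifP => // _; apply: HK => //.
by rewrite (leq_ltn_trans _ jt0) // -[leqRHS]odd_double_half -addnn addnCA leq_addr.
Qed.

(** * From limit computations to the halting problem *)

(** In [t] steps at most [t] input cells are read, so [t] copies of [j] suffice. Blanks read as 0
    and a missing block has value 0, which makes this a total function with no infinite argument. *)
Definition block_at (M : machine) (j i t : nat) : nat :=
  nth 0 (rev (parse_bits (mkseq (fun n =>
    odflt false (tape_get None (sim M (words (nseq t j)) t).1.2 n)) t)).1) i.

(** Further bits only add blocks at the front of the parsed list, that is at the end of its
    reversal. *)
Lemma nth_rev_parse w v i : i < size (parse_bits w).1 ->
  nth 0 (rev (parse_bits (w ++ v)).1) i = nth 0 (rev (parse_bits w).1) i.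
Proof.
rewrite parse_cat; move: (parse_bits w); elim: v => //= b v IH [s k] /= si.
rewrite IH; case: b => //=; last exact: ltnW.
by rewrite rev_cons nth_rcons size_rev si.
Qed.

(** Blocks [0] to [i] of [q] occupy [N] cells. Once these have settled, whatever stands beyond them
    cannot affect block [i]. *)
Lemma block_at_lim M j q i : produces M (fun=> j) q ->
  exists t0, forall t, t0 <= t -> block_at M j i t = q i.
Proof.
move=> HM; pose N := size (word q i.+1).
have [t0 Ht0] : exists t0, forall t n, t0 <= t -> n < N ->
    out (run M (tape (fun=> j)) t) n = Some (tape q n).
  elim: N => [|N [t0 Ht0]]; first by exists 0.
  have [t1 Ht1] := HM N; exists (maxn t0 t1) => t n; rewrite geq_max ltnS [n <= N]leq_eqVlt.
  by move=> /andP[h0 h1] /orP[/eqP->|nN]; [exact: Ht1|exact: Ht0].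
exists (maxn t0 N) => t; rewrite geq_max => /andP[t0t Nt].
have eo n : n < N -> odflt false (tape_get None (sim M (words (nseq t j)) t).1.2 n) = tape q n.
  move=> nN; rewrite out_sim (@run_ext _ _ (tape (fun=> j))) ?Ht0 // => s st.
  have e : words (nseq t j) = word (fun=> j) t.
    rewrite word_words; congr words; apply: (@eq_from_nth _ 0); rewrite size_nseq ?size_mkseq // => a at'.
    by rewrite nth_mkseq // nth_nseq at'.
  by rewrite e nth_word // (leq_trans st) // size_word.
rewrite /block_at; set f := fun n => _.
have -> : mkseq f t = word q i.+1 ++ map f (iota N (t - N)).
  rewrite /mkseq -{1}(subnKC Nt) iotaD map_cat; congr (_ ++ _).
  apply: (@eq_from_nth _ false); rewrite size_map size_iota // => n nN.
  by rewrite (nth_map 0) ?size_iota // nth_iota // add0n /f eo // nth_word.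
rewrite nth_rev_parse parse_word /= ?revK ?nth_mkseq //.
by rewrite size_rev size_mkseq.
Qed.

Lemma pr_foldr_iota (A B : countType) (c : A -> nat -> bool) (f : A -> nat -> B) (n : A -> nat) :
  pr (fun q : A * nat => c q.1 q.2) -> pr (fun q : A * nat => f q.1 q.2) -> pr n ->
  pr (fun a => foldr (fun t r => if c a t then Some (f a t) else r) None (iota 0 (n a))).
Proof.
move=> Hc Hf Hn.
have Hl : pr (fun a => mkseq id (n a)).
  by apply: (pr_mkseq (f := fun _ i => i)) => //; apply/pr_snd/pr_id.
have H : pr (fun q : A * nat * option B => if c q.1.1 q.1.2 then Some (f q.1.1 q.1.2) else q.2).
  apply: pr_if; [|apply: pr_some|apply/pr_snd/pr_id].
    exact: (pr_app Hc (pr_fst (pr_id _))).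
  exact: (pr_app Hf (pr_fst (pr_id _))).
apply: pr_ext (pr_foldr (f := fun a t r => if c a t then Some (f a t) else r)
  H (pr_const _ None) Hl) _ => a.
by rewrite /mkseq map_id.
Qed.

Lemma foldr_first (B : Type) (c : nat -> bool) (f : nat -> B) (l : seq nat) :
  match foldr (fun t r => if c t then Some (f t) else r) None l with
  | Some y => exists2 t, t \in l & c t /\ y = f t
  | None => forall t, t \in l -> ~~ c t
  end.
Proof.
elim: l => //= x l IH; case: ifP => cx; first by exists x; rewrite ?mem_head.
case: foldr IH => [y [t tl H]|H t]; first by exists t; rewrite ?inE ?tl ?orbT.
by rewrite inE => /orP[/eqP->|/H //]; rewrite cx.
Qed.

Lemma pr_block_at M (A : countType) (j i t : A -> nat) :
  pr j -> pr i -> pr t -> pr (fun a => block_at M (j a) (i a) (t a)).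
Proof.
move=> Hj Hi Ht; apply: pr_nth; [exact: pr_const| |exact: Hi].
apply: pr_rev; apply: pr_fst.
apply: (pr_foldl (f := fun _ => parse_bit)); [|exact: pr_const|].
  have Hb : pr (fun q : A * (seq nat * nat) * bool => q.2) by apply/pr_snd/pr_id.
  have Hs : pr (fun q : A * (seq nat * nat) * bool => q.1.2) by apply/pr_snd/pr_fst/pr_id.
  apply: pr_if Hb _ _; apply: pr_pair.
  - exact: pr_fst.
  - by apply/pr_succ/pr_snd.
  - by apply: pr_cons; [apply: pr_snd|apply: pr_fst].
  - exact: pr_const.
apply: (pr_mkseq (f := fun a n => odflt false
  (tape_get None (sim M (words (nseq (t a) (j a))) (t a)).1.2 n))) _ (Ht).
apply: pr_match_option _ _ (pr_const _ _); first by apply/pr_snd/pr_id.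
have Ht' : pr (fun q : A * nat => t q.1) by apply: (pr_app Ht); apply/pr_fst/pr_id.
apply: pr_tape_get; last by apply/pr_snd/pr_id.
apply: pr_snd; apply: pr_fst; apply: pr_sim => //; first exact: pr_const.
apply: pr_words; apply: pr_nseq => //.
by apply: (pr_app Hj); apply/pr_fst/pr_id.
Qed.

Lemma join_even r p i : join r p (2 * i) = r i.
Proof. by rewrite /join mul2n odd_double doubleK. Qed.

Lemma join_odd r p i : join r p (2 * i).+1 = p i.
Proof. by rewrite /join mul2n /= odd_double /= uphalf_double. Qed.

(** The oracle tells whether the value of a block still changes after time [t]. *)
Lemma oracle_machine M (nu shf : nat -> nat) : pr nu -> pr shf ->
  exists2 M', one_way M' & forall p Q,
    (forall k, produces M (fun=> p (nu k)) (Q k)) ->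
    produces M' (join halting_problem p) (fun k => Q k (shf k)).
Proof.
move=> Hnu Hshf.
pose dc (c : nat) : nat * nat * nat := odflt (0, 0, 0) (unpickle c).
have Hdc : pr dc.
  apply: (@pr_match_option nat (nat * nat * nat)%type (nat * nat * nat)%type
    unpickle (fun _ x => x)) _ _ (pr_const _ _).
    by apply: pr_snd; apply: pr_id.
  by do 2?apply: decodable_pair; exact: decodable_nat.
(* For [c] coding [(j, i, t)], a witness [s] is a delay after which block [i] differs from its value
   at time [t]. *)
pose chi (a : nat * nat) : bool :=
  ~~ (block_at M (dc a.1).1.1 (dc a.1).1.2 ((dc a.1).2 + a.2) ==
      block_at M (dc a.1).1.1 (dc a.1).1.2 (dc a.1).2).
have Hchi : pr chi.
  have Hd : pr (fun a : nat * nat => dc a.1) by apply: (pr_app Hdc); apply/pr_fst/pr_id.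
  apply: pr_neg; apply: pr_eq; apply: pr_block_at;
    try (by do 2!apply: pr_fst); try (by apply: pr_snd; apply: pr_fst); try exact: pr_snd.
  by apply: pr_addn; [apply: pr_snd|apply/pr_snd/pr_id].
have [h Hh hP] := halting_index Hchi.
have hs j i t : halting_problem (h (pickle (j, i, t))) = 0 <->
    forall s, block_at M j i (t + s) = block_at M j i t.
  rewrite hP /chi /dc /= pickleK /=; split=> H s; have := H s; first by rewrite negbK => /eqP.
  by move=> ->; rewrite eqxx.
pose arg (a : nat * seq nat) := nth 0 a.2 (2 * nu a.1).+1.
(* The search runs over times [t] for which the oracle denies any later change. An oracle entry not
   yet read counts as 1, that is as a change to come, so that no answer rests on missing
   information. *)
pose psi (a : nat * seq nat) : option nat :=
  if (2 * nu a.1).+1 < size a.2 then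
    foldr (fun t r => if nth 1 a.2 (2 * h (pickle (arg a, shf a.1, t))) == 0
      then Some (block_at M (arg a) (shf a.1) t) else r) None (iota 0 (size a.2))
  else None.
have Hidx : pr (fun a : nat * seq nat => (2 * nu a.1).+1).
  by apply: pr_succ; apply: pr_muln; [exact: pr_const|apply: (pr_app Hnu); apply/pr_fst/pr_id].
have Hvs : pr (fun a : nat * seq nat => a.2) by apply/pr_snd/pr_id.
have Harg : pr arg by apply: pr_nth => //; exact: pr_const.
have Hsh : pr (fun a : nat * seq nat => shf a.1) by apply: (pr_app Hshf); apply/pr_fst/pr_id.
have Hpsi : pr psi.
  apply: pr_if; [|apply: pr_foldr_iota|exact: pr_const]; last exact: pr_size.
  - by apply: pr_leq; [exact: pr_succ|exact: pr_size].
  - have up (B : countType) (g : nat * seq nat -> B) : pr g -> pr (fun p : nat * seq nat * nat => g p.1).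
      by move=> Hg; apply: (pr_app Hg); apply/pr_fst/pr_id.
    apply: pr_eq (pr_const _ _); apply: pr_nth; [exact: pr_const|exact: (up _ _ Hvs)|].
    apply: pr_muln; first exact: pr_const.
    apply: (pr_app Hh); apply: pr_pickle; do 2?apply: pr_pair;
      [exact: (up _ _ Harg)|exact: (up _ _ Hsh)|apply/pr_snd/pr_id].
  - apply: pr_block_at; last by apply/pr_snd/pr_id.
      by apply: (pr_app Harg); apply/pr_fst/pr_id.
    by apply: (pr_app Hsh); apply/pr_fst/pr_id.
have [M' M'1 HM'] := one_way_machine Hpsi; exists M' => // p Q HQ.
set x := join _ _.
have xe m : x (2 * m) = halting_problem m := join_even _ _ m.
have xo m : x (2 * m).+1 = p m := join_odd _ _ m.
have stable k t : halting_problem (h (pickle (p (nu k), shf k, t))) = 0 ->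
    block_at M (p (nu k)) (shf k) t = Q k (shf k).
  move=> /hs H; have [t0 Ht0] := block_at_lim (shf k) (HQ k).
  by rewrite -(Ht0 (t + t0)) ?leq_addl // H.
apply: HM' => [k K v|k].
  rewrite /psi /arg /= size_mkseq; case: ltnP => // lt.
  rewrite nth_mkseq // xo; set l := foldr _ _ _ => e.
  have := foldr_first (fun t => nth 1 (mkseq x K) (2 * h (pickle (p (nu k), shf k, t))) == 0)
    (block_at M (p (nu k)) (shf k)) (iota 0 K).
  rewrite -/l e => -[t _ [/eqP ct ->]]; apply: stable.
  case: (ltnP (2 * h (pickle (p (nu k), shf k, t))) K) => [lt'|ge].
    by move: ct; rewrite nth_mkseq // xe.
  by move: ct; rewrite nth_default // size_mkseq.
have [t0 Ht0] := block_at_lim (shf k) (HQ k).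
have h0 : halting_problem (h (pickle (p (nu k), shf k, t0))) = 0.
  by apply/hs => s; rewrite !Ht0 // leq_addr.
pose a := 2 * h (pickle (p (nu k), shf k, t0)).
exists (maxn (2 * nu k).+2 (maxn a.+1 t0.+1)) => K; rewrite !geq_max => /and3P[k1 k2 k3].
rewrite /psi /arg /= size_mkseq k1 nth_mkseq // xo; set l := foldr _ _ _ => e.
have := foldr_first (fun t => nth 1 (mkseq x K) (2 * h (pickle (p (nu k), shf k, t))) == 0)
  (block_at M (p (nu k)) (shf k)) (iota 0 K).
rewrite -/l e => /(_ t0); rewrite mem_iota add0n => /(_ k3).
by rewrite -/a nth_mkseq // /a xe h0.
Qed.

Import Order.TTheory GRing.Theory Num.Theory.
Import numFieldNormedType.Exports.

Local Open Scope classical_set_scope.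
Local Open Scope ring_scope.

(** * Cauchy names *)

Lemma cvg_mdistP (R : realType) (X : metricType R) (u : nat -> X) (x : X) :
  u @ \oo --> x <->
  forall e, 0 < e -> exists N, forall n, (N <= n)%N -> mdist x (u n) < e.
Proof.
split=> [/cvg_ballP H e e0|H].
  have [N _ HN] := H _ e0; exists N => n Nn.
  by have := HN n Nn; rewrite /= ballEmdist.
apply/cvg_ballP => e e0; have [N HN] := H e e0.
by exists N => // n Nn; rewrite /= ballEmdist; exact: HN.
Qed.

Lemma exp_half_lt (R : realType) (e : R) : 0 < e -> exists k, (2^-1 : R) ^+ k < e.
Proof.
move=> e0; have [N _ HN] := near_infty_natSinv_expn_lt (PosNum e0).
exists N; have := HN N (leqnn N); rewrite /= mul1r exprVn.
by [].
Qed.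

Section Names.
Variables (R : realType) (X : computableMetricSpace R).

Lemma cauchy_rep_dist p (x : X) k : cauchy_rep p x ->
  mdist (cms_seq X (p k)) x <= 2^-1 ^+ k.
Proof.
move=> [H /cvg_mdistP cv]; apply/ler_addgt0Pr => e e0.
have [N HN] := cv e e0; pose n := maxn N k.
apply: (le_trans (metric_triangle _ (cms_seq X (p n)) _)); apply: lerD.
  by rewrite metric_sym ltW // H // leq_maxr.
by rewrite metric_sym ltW // HN // leq_maxl.
Qed.

(** Two errors of [2 ^ (- (k + 2))] add up to half of [2 ^ (- k)], which leaves room for the strict
    inequality in the definition of names. *)
Lemma cauchy_rep_fast q (y : X) :
  (forall k, mdist (cms_seq X (q k)) y <= 2^-1 ^+ k.+2) -> cauchy_rep q y.
Proof.
move=> H; split=> [k n kn|].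
  apply: (le_lt_trans (metric_triangle _ y _)).
  apply: (@le_lt_trans _ _ (2^-1 ^+ k.+2 + 2^-1 ^+ k.+2)).
    apply: lerD; last by rewrite metric_sym.
    apply: (le_trans (H n)); apply: ler_wiXn2l; rewrite ?invr_ge0 ?invf_le1 ?ler1n //.
  by have : 0 < (2^-1 : R) ^+ k; [rewrite exprn_gt0|rewrite !exprSr; lra].
apply/cvg_mdistP => e e0; have [k Hk] := exp_half_lt e0; exists k => n kn.
rewrite metric_sym (le_lt_trans (H n)) // (le_lt_trans _ Hk) //.
by apply: ler_wiXn2l; rewrite ?invr_ge0 ?invf_le1 ?ler1n // (leq_trans kn) // leqW.
Qed.

Lemma cauchy_rep_const j : cauchy_rep (fun=> j) (cms_seq X j).
Proof.
by split=> [k n _|]; [rewrite mdistxx exprn_gt0|exact: cvg_cst].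
Qed.

End Names.

(** * The Hölder modulus and the equivalence *)

Lemma holder_modulus (R : realType) (L a : R) : 0 < a -> exists c d : nat,
  forall k, L * (2^-1 ^+ (c * (k + d))) `^ a <= 2^-1 ^+ k.
Proof.
move=> a0; have [d Hd] : exists d : nat, L <= 2 ^+ d.
  exists (Num.truncn L).+1; rewrite (le_trans (ltW (truncnS_gt L))) //.
  by rewrite -natrX ler_nat ltnW // ltn_expl.
exists (Num.truncn a^-1).+1, d => k; set c := (Num.truncn _).+1.
have ac : 1 <= c%:R * a by rewrite -ler_pdivrMr // div1r; exact: ltW (truncnS_gt _).
have h : (2^-1 ^+ (c * (k + d)) : R) `^ a <= 2^-1 ^+ (k + d).
  rewrite -!powR_mulrn ?invr_ge0 // -powRrM; apply: ger_powR.
    by rewrite invr_gt0 ltr0n invf_le1 ?ler1n.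
  by rewrite natrM mulrAC ler_peMl.
apply: (@le_trans _ _ (2 ^+ d * 2^-1 ^+ (k + d))).
  apply: (le_trans (ler_wpM2r (powR_ge0 _ _) Hd)).
  by rewrite ler_wpM2l ?exprn_ge0.
by rewrite exprD mulrCA -exprMn mulfV // expr1n mulr1.
Qed.

Theorem corollary6p15 (R : realType) (X Y : computableMetricSpace R)
    (f : X -> Y) (hf : holder_continuous f) :
  limit_computable_map f <-> computable_map_relative_to halting_problem f.
Proof.
split=> -[F HF]; last by move=> /relative_limit; exists F.
move=> [M HM]; have [L [a [L0 a0 _ Hf]]] := hf.
have [c [d Hcd]] := holder_modulus L a0.
(* There are two errors, from the name of the value at the dense point and from moving to [x]. Each
   is at most [2 ^ (- (k + 3))], so their sum is the [2 ^ (- (k + 2))] of [cauchy_rep_fast]. *)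
pose nu k := (c * (k + 3 + d))%N; pose shf k := (k + 3)%N.
have Hnu : pr nu.
  by apply: pr_muln; [exact: pr_const|do 2?apply: pr_addn; try exact: pr_const; exact: pr_id].
have Hshf : pr shf by apply: pr_addn; [exact: pr_id|exact: pr_const].
pose Q j : baire := odflt zero_seq (F (fun=> j)).
have HQ j : F (fun=> j) = Some (Q j) /\ cauchy_rep (Q j) (f (cms_seq X j)).
  by have [q e Hq] := HF _ _ (cauchy_rep_const X j); rewrite /Q e.
have [M' M'1 HM'] := oracle_machine M Hnu Hshf.
pose q (p : baire) : baire := fun k => Q (p (nu k)) (shf k).
(* Every constant sequence is a name, so [q p] is computed for all [p], and the realizer can be
   total. *)
exists (fun p => Some (q p)).
  move=> p x px; exists (q p) => //; apply: cauchy_rep_fast => k.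
  apply: (le_trans (metric_triangle _ (f (cms_seq X (p (nu k)))) _)).
  apply: (@le_trans _ _ (2^-1 ^+ (k + 3) + 2^-1 ^+ (k + 3))).
    apply: lerD; first by have [_ /(cauchy_rep_dist (k + 3))] := HQ (p (nu k)).
    apply: le_trans (Hf _ _) _; apply: le_trans (Hcd (k + 3)%N).
    rewrite ler_pM2l //; apply: ge0_ler_powR; rewrite ?nnegrE ?exprn_ge0 ?invr_ge0 ?mdist_ge0 //.
      exact: ltW.
    exact: cauchy_rep_dist.
  by rewrite addn3 [X in X + X <= _]exprSr; lra.
(* [M'] is known to be right with the true oracle only, so [G] is defined just where the even
   entries are those of the halting problem. *)
exists (fun x => if `[< forall i, x (2 * i)%N = halting_problem i >] then
    Some (fun k => Q (x (2 * nu k).+1) (shf k)) else None).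
  exists M' => // x y; case: asboolP => // Hx [<-].
  have -> : produces M' x = produces M' (join halting_problem (fun i => x (2 * i).+1)).
    congr produces; apply/funext => n; rewrite /join; case: ifP => on.
      by rewrite -[in LHS](odd_double_half n) on mul2n.
    by rewrite -Hx -[in LHS](odd_double_half n) on mul2n.
  by apply: (HM' _ (fun k => Q (x (2 * nu k).+1))) => k; apply: HM; have [] := HQ (x (2 * nu k).+1).
move=> p _ [<-]; rewrite ifT.
  by congr Some; apply/funext => k; rewrite join_odd.
by apply/asboolP => i; exact: join_even.
Qed.
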